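(* Let $G\in\Gamma$ be a twin-free, connected bipartite graph. For each $k\in\{1,2,3,4,5,6\}$ the following are equivalent: (1) $E_k\le G\le F_k$; (2) $\|G\|=\eta_k$; (3) $\eta_{k-1}<\|G\|\le\eta_k$.
   Context: $\Gamma$ is the collection of all bipartite graphs $G\subseteq R\times C$ with $|R|,|C|\in\{1,2,\dots\}\cup\{\aleph_0\}$; the biadjacency matrix $M(G)$ has $(i,j)$ entry $1$ iff $(r_i,c_j)$ is an edge. $\|G\|$ is the Schur norm $\|M(G)\|_\bullet=\sup\{\|M(G)\bullet X\|:\|X\|\le1\}$ (entrywise product $[a_{ij}x_{ij}]$, operator norm on $\ell^2$ spaces over $\mathbb F\in\{\mathbb R,\mathbb C\}$). Two vertices are twins if they have the same neighbour sets; twin-free means no two distinct vertices are twins. $H\le G$ means $G$ has an induced subgraph $G\cap(R_0\times C_0)$ isomorphic to $H$ (isomorphisms of bipartite graphs may swap the two sides). Constants: $\eta_0=0,\ \eta_1=1,\ \eta_2=\sqrt{4/3},\ \eta_3=\frac{1+\sqrt2}2,\ \eta_4=\frac1{15}\sqrt{169+38\sqrt{19}},\ \eta_5=\sqrt{3/2},\ \eta_6=\frac25\sqrt{5+2\sqrt5}$. Graphs $E_k,F_k$ are given by biadjacency matrices: $E_1=F_1=[1]$; $E_2=\begin{bmatrix}1&1\\0&1\end{bmatrix}$, $F_2=\begin{bmatrix}1&1&0\\0&1&1\end{bmatrix}$; $E_3=\begin{bmatrix}1&1&0\\0&1&1\\0&0&1\end{bmatrix}$, $F_3=\begin{bmatrix}1&1&0&0\\1&0&1&0\\0&1&0&1\\0&0&1&1\end{bmatrix}$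 (an 8-cycle); $E_4=\begin{bmatrix}1&0&0\\1&1&1\\0&0&1\end{bmatrix}$, $F_4=\begin{bmatrix}1&0&0&1&0\\1&1&1&0&0\\0&0&1&0&1\end{bmatrix}$; $E_5=F_5=\begin{bmatrix}1&1&0&0\\1&0&1&0\\1&0&0&1\end{bmatrix}$; $E_6=\begin{bmatrix}1&1&0&0\\0&1&1&0\\0&0&1&1\\0&0&0&1\end{bmatrix}$, $F_6=\begin{bmatrix}1&1&0&0&0\\0&1&1&0&0\\0&0&1&1&0\\0&0&0&1&1\end{bmatrix}$. *)

(* Defs.v *)
From HB Require Import structures.
From mathcomp Require Import all_boot all_order all_algebra.
From mathcomp Require Import all_classical all_reals ereal.
From mathcomp Require Import complex.
From Stdlib Require Import Relations.

Set Implicit Arguments.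
Unset Strict Implicit.
Unset Printing Implicit Defensive.

Import Order.TTheory GRing.Theory Num.Theory.
Local Open Scope ring_scope.

(* Vertex sets.  A side of size n in {1,2,...} is {0,...,n-1} (encoded  *)
(* [Some n]); a side of size aleph_0 is all of nat (encoded [None]).    *)
Definition inV (s : option nat) (i : nat) : bool :=
  if s is Some n then (i < n)%N else true.

Definition size_ok (s : option nat) : bool :=
  if s is Some n then (0 < n)%N else true.

Record bigraph := BiGraph {
  nR : option nat;
  nC : option nat;
  adj : nat -> nat -> bool }.

Definition in_Gamma (G : bigraph) : bool := size_ok (nR G) && size_ok (nC G).

Definition edge (G : bigraph) (i j : nat) : bool :=
  [&& inV (nR G) i, inV (nC G) j & adj G i j].

Definition twin_free (G : bigraph) : Prop :=
  (forall i i', inV (nR G) i -> inV (nR G) i' ->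
     (forall j, inV (nC G) j -> edge G i j = edge G i' j) -> i = i') /\
  (forall j j', inV (nC G) j -> inV (nC G) j' ->
     (forall i, inV (nR G) i -> edge G i j = edge G i j') -> j = j').

Definition vok (G : bigraph) (u : nat + nat) : bool :=
  match u with inl i => inV (nR G) i | inr j => inV (nC G) j end.

Definition vadj (G : bigraph) (u v : nat + nat) : Prop :=
  match u, v with
  | inl i, inr j => edge G i j
  | inr j, inl i => edge G i j
  | _, _ => False
  end.

Definition bg_connected (G : bigraph) : Prop :=
  forall u v, vok G u -> vok G v -> clos_refl_trans (nat + nat) (vadj G) u v.

Definition emb_ok (sH sG : option nat) (f : nat -> nat) : Prop :=
  (forall i, inV sH i -> inV sG (f i)) /\
  (forall i i', inV sH i -> inV sH i' -> f i = f i' -> i = i').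

Definition ind_le (H G : bigraph) : Prop :=
  exists f g : nat -> nat,
    (emb_ok (nR H) (nR G) f /\ emb_ok (nC H) (nC G) g /\
     forall i j, inV (nR H) i -> inV (nC H) j -> edge H i j = edge G (f i) (g j))
  \/
    (emb_ok (nR H) (nC G) f /\ emb_ok (nC H) (nR G) g /\
     forall i j, inV (nR H) i -> inV (nC H) j -> edge H i j = edge G (g j) (f i)).

Definition Fld (R : realType) (b : bool) : numFieldType :=
  if b then (R[i] : numFieldType) else (R : numFieldType).

Definition mod2 (R : realType) (b : bool) : Fld R b -> R :=
  match b return Fld R b -> R with
  | true => fun z : R[i] => complex.Re z ^+ 2 + complex.Im z ^+ 2
  | false => fun x : R => x ^+ 2
  end.

(* Operator norm of a matrix X (indexed by R × C) from l^2(C) to l^2(R):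
   sup of ||X v|| over finitely supported v in l^2(C) with ||v|| <= 1, the
   l^2 norm of X v being the sup of its partial sums.  (+oo if X does not
   define a bounded operator.) *)
Definition opnorm (R : realType) (b : bool) (sR sC : option nat)
    (X : nat -> nat -> Fld R b) : \bar R :=
  ereal_sup [set y : \bar R | exists (M N : nat) (v : nat -> Fld R b),
    \sum_(j < N | inV sC j) mod2 (v j) <= 1 /\
    y = (Num.sqrt (\sum_(i < M | inV sR i)
            mod2 (\sum_(j < N | inV sC j) X i j * v j)))%:E].

Definition schurM (R : realType) (b : bool) (G : bigraph)
    (X : nat -> nat -> Fld R b) : nat -> nat -> Fld R b :=
  fun i j => if edge G i j then X i j else 0.

Definition schur_norm (R : realType) (b : bool) (G : bigraph) : \bar R :=
  ereal_sup [set y : \bar R | exists X : nat -> nat -> Fld R b,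
    (opnorm (nR G) (nC G) X <= 1%:E)%E /\
    y = opnorm (nR G) (nC G) (schurM G X)].

Definition mxg (rows : seq (seq nat)) : bigraph :=
  BiGraph (Some (size rows)) (Some (size (head [::] rows)))
    (fun i j => nth 0%N (nth [::] rows i) j == 1%N).

Definition E_ (k : nat) : bigraph :=
  match k with
  | 1 => mxg [:: [:: 1]]
  | 2 => mxg [:: [:: 1; 1]; [:: 0; 1]]
  | 3 => mxg [:: [:: 1; 1; 0]; [:: 0; 1; 1]; [:: 0; 0; 1]]
  | 4 => mxg [:: [:: 1; 0; 0]; [:: 1; 1; 1]; [:: 0; 0; 1]]
  | 5 => mxg [:: [:: 1; 1; 0; 0]; [:: 1; 0; 1; 0]; [:: 1; 0; 0; 1]]
  | 6 => mxg [:: [:: 1; 1; 0; 0]; [:: 0; 1; 1; 0]; [:: 0; 0; 1; 1];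
               [:: 0; 0; 0; 1]]
  | _ => mxg [:: [:: 1]]
  end%N.

Definition F_ (k : nat) : bigraph :=
  match k with
  | 1 => mxg [:: [:: 1]]
  | 2 => mxg [:: [:: 1; 1; 0]; [:: 0; 1; 1]]
  | 3 => mxg [:: [:: 1; 1; 0; 0]; [:: 1; 0; 1; 0]; [:: 0; 1; 0; 1];
               [:: 0; 0; 1; 1]]
  | 4 => mxg [:: [:: 1; 0; 0; 1; 0]; [:: 1; 1; 1; 0; 0]; [:: 0; 0; 1; 0; 1]]
  | 5 => mxg [:: [:: 1; 1; 0; 0]; [:: 1; 0; 1; 0]; [:: 1; 0; 0; 1]]
  | 6 => mxg [:: [:: 1; 1; 0; 0; 0]; [:: 0; 1; 1; 0; 0]; [:: 0; 0; 1; 1; 0];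
               [:: 0; 0; 0; 1; 1]]
  | _ => mxg [:: [:: 1]]
  end%N.

Definition eta_k (R : realType) (k : nat) : R :=
  match k with
  | 0%N => 0
  | 1%N => 1
  | 2%N => Num.sqrt (4%:R / 3%:R)
  | 3%N => (1 + Num.sqrt 2%:R) / 2%:R
  | 4%N => 15%:R^-1 * Num.sqrt (169%:R + 38%:R * Num.sqrt 19%:R)
  | 5%N => Num.sqrt (3%:R / 2%:R)
  | 6%N => 2%:R / 5%:R * Num.sqrt (5%:R + 2%:R * Num.sqrt 5%:R)
  | _ => 0
  end.

(* Main.v *)
From Stdlib Require Import Relations ZArith.
Require Import Defs.
From mathcomp Require Import all_boot all_order all_algebra.
From mathcomp Require Import all_classical all_reals ereal.
From mathcomp Require Import complex ring lra zify ssrZ.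

(** The Schur norm of a 0/1 matrix is bounded above by exhibiting its entries
    as inner products of vectors of bounded norm, and below by testing it on
    one contraction: if [Z] satisfies [2 u Z w <= sum p u^2 + sum q w^2] then
    [D(p)^(-1/2) Z D(q)^(-1/2)] is a contraction, and the vectors [sqrt p] and
    [sqrt q] detect the sum of [Z] over the edges.  Both bounds pass to induced
    subgraphs, and for [E_k] and [F_k] they meet at [eta_k], with all data in a
    real quadratic field.  Nine further graphs have norm above [eta_6]; a
    connected twin-free graph that contains none of them is grown one vertex at
    a time from an edge, adding a vertex that separates a pair of twins whenever
    there is one.  A finite search shows that the growth stops at a graph lying
    between some [E_k] and [F_k]. *)

Set Implicit Arguments.
Unset Strict Implicit.
Unset Printing Implicit Defensive.

Import Order.TTheory GRing.Theory Num.Theory.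
Local Open Scope ring_scope.

(** The 4-cycle and the star with four leaves have norm 1, so no bound on the norm excludes them.
    Only twin-freeness does: separating their twins forces one of the nine graphs. Two small
    searches dispose of them before the main one, which then meets only graphs of maximum degree
    three without 4-cycles. The path on ten vertices is among the nine, so the diameter is bounded
    too and the search can be finite. Infinite graphs are thereby settled as well: none survives.
    The two bounds on the norm are dual to each other, the upper one being the factorisation form of
    the Schur norm, so one can hope for certificates that meet. They have to meet exactly, because
    (2) is an equality; hence exact arithmetic instead of approximation. Only the nine graphs leave
    a margin, and it is small. *)

Lemma ler_eq (R : realType) (x y : R) : x = y -> x <= y.
Proof. by move=> ->. Qed.

(** * Real and complex scalars treated together *)

Section Scalars.
Variables (R : realType) (b : bool).
Local Notation K := (Fld R b).

(** Real weights act separately on [repart] and [impart]. All factorisations and test matrices below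
    are real, so an estimate is proved once for a real-linear [h] and then added up over the two
    parts. *)
Definition scal : R -> K :=
  match b return R -> Fld R b with
  | true => fun a : R => (a%:C)%C : R[i]
  | false => fun a => a
  end.

Definition repart : K -> R :=
  match b return Fld R b -> R with
  | true => fun z : R[i] => complex.Re z
  | false => fun x : R => x
  end.

Definition impart : K -> R :=
  match b return Fld R b -> R with
  | true => fun z : R[i] => complex.Im z
  | false => fun x : R => 0
  end.

End Scalars.

Section ScalarTheory.
Variables (R : realType) (b : bool).
Local Notation K := (Fld R b).
Implicit Types (z : K) (a : R).

Lemma mod2E z : mod2 z = repart z ^+ 2 + impart z ^+ 2.
Proof. by case: b z => //= z; rewrite expr0n addr0. Qed.

Lemma mod2_ge0 z : 0 <= mod2 z.
Proof. by rewrite mod2E addr_ge0 ?sqr_ge0. Qed.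

Lemma repart0 : repart (0 : K) = 0.
Proof. by case: b. Qed.

Lemma impart0 : impart (0 : K) = 0.
Proof. by case: b. Qed.

Lemma repartD : {morph @repart R b : x y / x + y}.
Proof. by case: b => //= -[x1 x2] [y1 y2]. Qed.

Lemma impartD : {morph @impart R b : x y / x + y}.
Proof. by case: b => [|x y] /=; [case=> x1 x2 [y1 y2] | rewrite addr0]. Qed.

Lemma repart_sum I (r : seq I) (P : pred I) (F : I -> K) :
  repart (\sum_(i <- r | P i) F i) = \sum_(i <- r | P i) repart (F i).
Proof. exact: (big_morph _ repartD repart0). Qed.

Lemma impart_sum I (r : seq I) (P : pred I) (F : I -> K) :
  impart (\sum_(i <- r | P i) F i) = \sum_(i <- r | P i) impart (F i).
Proof. exact: (big_morph _ impartD impart0). Qed.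

Lemma repartZ a z : repart (scal b a * z) = a * repart z.
Proof. by case: b z => //= -[x y] /=; rewrite mul0r subr0. Qed.

Lemma impartZ a z : impart (scal b a * z) = a * impart z.
Proof. by case: b z => [[x y]|z] /=; rewrite ?mul0r ?addr0 ?mulr0. Qed.

Lemma repart_scal a : repart (scal b a) = a.
Proof. by case: b. Qed.

Lemma impart_scal a : impart (scal b a) = 0.
Proof. by case: b. Qed.

Lemma mod2Z a z : mod2 (scal b a * z) = a ^+ 2 * mod2 z.
Proof. by rewrite !mod2E repartZ impartZ; ring. Qed.

Lemma mod2_scal a : mod2 (scal b a) = a ^+ 2.
Proof. by rewrite mod2E repart_scal impart_scal expr0n addr0. Qed.

(** Lagrange's identity: twice the difference of the two sides is the double sum of
    [l i * l j * (x i * y j - x j * y i) ^+ 2]. *)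
Lemma wgt_cauchy_schwarz (I : Type) (r : seq I) (P : pred I) (l x y : I -> R) :
  (forall i, P i -> 0 <= l i) ->
  (\sum_(i <- r | P i) l i * (x i * y i)) ^+ 2 <=
  (\sum_(i <- r | P i) l i * x i ^+ 2) * (\sum_(i <- r | P i) l i * y i ^+ 2).
Proof.
move=> l0; rewrite -subr_ge0 -(pmulr_rge0 _ (ltr0n R 2)).
set s := (X in 0 <= X).
suff -> : s = \sum_(i <- r | P i) \sum_(j <- r | P j)
    l i * l j * (x i * y j - x j * y i) ^+ 2.
  apply: sumr_ge0 => i Pi; apply: sumr_ge0 => j Pj.
  by rewrite mulr_ge0 ?sqr_ge0 ?mulr_ge0 ?l0.
transitivity (\sum_(i <- r | P i) \sum_(j <- r | P j)
   ((l i * x i ^+ 2) * (l j * y j ^+ 2) + (l i * y i ^+ 2) * (l j * x j ^+ 2)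
     + (- 2) * (l i * (x i * y i)) * (l j * (x j * y j)))); last first.
  by apply: eq_bigr => i _; apply: eq_bigr => j _; ring.
under eq_bigr => i _ do rewrite !big_split /= -!mulr_sumr.
rewrite !big_split /= -!mulr_suml -mulr_sumr /s; ring.
Qed.

End ScalarTheory.

(** * Operator norm tested on finitely supported vectors *)

Section OperatorNorm.
Variables (R : realType) (b : bool).
Local Notation K := (Fld R b).
Implicit Types (sR sC : option nat) (X : nat -> nat -> K) (c : R).

Lemma opnorm_le sR sC X c : 0 <= c ->
  (forall M N (v : nat -> K), \sum_(j < N | inV sC j) mod2 (v j) <= 1 ->
     \sum_(i < M | inV sR i) mod2 (\sum_(j < N | inV sC j) X i j * v j)
       <= c ^+ 2) ->
  (opnorm sR sC X <= c%:E)%E.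
Proof.
move=> c0 H; apply: ge_ereal_sup => y [M [N [v [v1 ->]]]].
rewrite lee_fin -(ger0_norm c0) -sqrtr_sqr; apply: ler_wsqrtr.
exact: H.
Qed.

Lemma le_opnorm sR sC X c M N (v : nat -> K) :
  \sum_(j < N | inV sC j) mod2 (v j) <= 1 ->
  c ^+ 2 <= \sum_(i < M | inV sR i) mod2 (\sum_(j < N | inV sC j) X i j * v j) ->
  (c%:E <= opnorm sR sC X)%E.
Proof.
move=> v1 H; apply: (le_trans (y := (Num.sqrt (\sum_(i < M | inV sR i)
            mod2 (\sum_(j < N | inV sC j) X i j * v j)))%:E)).
  by rewrite lee_fin (le_trans (ler_norm c)) // -sqrtr_sqr ler_wsqrtr.
by apply: ereal_sup_ubound; exists M, N, v.
Qed.

Lemma contractionP sR sC X M N (v : nat -> K) :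
  (opnorm sR sC X <= 1%:E)%E ->
  \sum_(i < M | inV sR i) mod2 (\sum_(j < N | inV sC j) X i j * v j) <=
  \sum_(j < N | inV sC j) mod2 (v j).
Proof.
move=> X1; set L := (X in X <= _); set S := (X in _ <= X).
have L0 : 0 <= L by apply: sumr_ge0 => i _; exact: mod2_ge0.
have S0 : 0 <= S by apply: sumr_ge0 => i _; exact: mod2_ge0.
have key t : t ^+ 2 * S <= 1 -> t ^+ 2 * L <= 1.
  move=> tS.
  have := le_trans (@le_opnorm sR sC X (Num.sqrt (t ^+ 2 * L)) M N
    (fun j => scal b t * v j) _ _) X1.
  rewrite lee_fin => H; have {H}: Num.sqrt (t ^+ 2 * L) <= 1.
    apply: H; first by under eq_bigr do rewrite mod2Z; rewrite -mulr_sumr.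
    rewrite sqr_sqrtr; last by rewrite mulr_ge0 // sqr_ge0.
    rewrite /L mulr_sumr; apply: ler_sum => i _.
    rewrite -mod2Z mulr_sumr; apply: ler_eq; congr mod2.
    by apply: eq_bigr => j _; rewrite mulrCA.
  by rewrite -[X in _ <= X -> _]sqrtr1 ler_sqrt ?ltr01.
rewrite leNgt; apply/negP => SL.
(* If [S < L], a scaling with [t ^+ 2 = 2 / (L + S)] gives [t ^+ 2 * S < 1 < t ^+ 2 * L], against
   [key]. This avoids dividing by [S], which may vanish. *)
have LS : 0 < L + S by lra.
have e y : (2 / (L + S) * y <= 1) = (2 * y <= L + S).
  by rewrite mulrAC ler_pdivrMr // mul1r.
have := key (Num.sqrt (2 / (L + S))).
rewrite sqr_sqrtr; last by rewrite divr_ge0 ?ler0n // ltW.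
by rewrite !e => H; have := H ltac:(lra); lra.
Qed.

End OperatorNorm.

(** * Upper bound from a Gram factorisation *)

Section UpperBound.
Variables (R : realType) (b : bool) (G : bigraph).
Local Notation K := (Fld R b).

(* Factoring the 0/1 matrix of G through weighted vectors al i, be j
   writes its Schur product with X as the sum over k of
   D(al _ k) X D(be _ k); Cauchy-Schwarz in k then bounds the norm. *)
Lemma schur_norm_le_gram (r : nat) (lam : nat -> R) (al be : nat -> nat -> R)
    (P Q c : R) :
  (forall k, (k < r)%N -> 0 <= lam k) -> 0 <= P -> 0 <= Q -> 0 <= c ->
  P * Q <= c ^+ 2 ->
  (forall i j, inV (nR G) i -> inV (nC G) j ->
     \sum_(k < r) lam k * (al i k * be j k) = (edge G i j)%:R) ->
  (forall i, inV (nR G) i -> \sum_(k < r) lam k * al i k ^+ 2 <= P) ->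
  (forall j, inV (nC G) j -> \sum_(k < r) lam k * be j k ^+ 2 <= Q) ->
  (schur_norm R b G <= c%:E)%E.
Proof.
move=> lam0 P0 Q0 c0 PQ MG alP beQ; apply: ge_ereal_sup => y [X [X1 ->]].
apply: opnorm_le => // M N v v1; apply: le_trans PQ.
pose w k j := scal b (be j k) * v j.
pose W i k := \sum_(j < N | inV (nC G) j) X i j * w k j.
have part (h : K -> R) : (forall I (s : seq I) (p : pred I) (F : I -> K),
    h (\sum_(i <- s | p i) F i) = \sum_(i <- s | p i) h (F i)) ->
    (forall a z, h (scal b a * z) = a * h z) -> h 0 = 0 ->
    forall i, inV (nR G) i ->
    h (\sum_(j < N | inV (nC G) j) schurM G X i j * v j) ^+ 2 <=
    P * \sum_(k < r) lam k * h (W i k) ^+ 2.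
  move=> hsum hZ h0 i iR; have -> :
      h (\sum_(j < N | inV (nC G) j) schurM G X i j * v j) =
      \sum_(k < r) lam k * (al i k * h (W i k)).
    transitivity (\sum_(j < N | inV (nC G) j) \sum_(k < r)
        lam k * (al i k * be j k) * h (X i j * v j)).
      rewrite hsum; apply: eq_bigr => j jC; rewrite -mulr_suml MG //.
      by rewrite /schurM; case: ifP => _; rewrite ?mul1r // !mul0r h0.
    rewrite exchange_big; apply: eq_bigr => k _ /=.
    rewrite /W hsum !mulr_sumr; apply: eq_bigr => j _.
    by rewrite /w [X i j * (_ * _)]mulrCA hZ; ring.
  apply: le_trans (wgt_cauchy_schwarz _ _ _ _) _.
    by move=> k _; exact: lam0.
  apply: ler_wpM2r; last exact: alP.
  by apply: sumr_ge0 => k _; rewrite mulr_ge0 ?sqr_ge0 ?lam0.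
apply: (@le_trans _ _ (\sum_(i < M | inV (nR G) i)
   P * \sum_(k < r) lam k * mod2 (W i k))).
  apply: ler_sum => i iR; rewrite mod2E.
  have := part (@repart R b) (@repart_sum R b) (@repartZ R b) (@repart0 R b) i iR.
  have := part (@impart R b) (@impart_sum R b) (@impartZ R b) (@impart0 R b) i iR.
  move=> h1 h2; apply: le_trans (lerD h2 h1) _.
  rewrite -mulrDr -big_split /=; apply: ler_eq; congr (_ * _).
  by apply: eq_bigr => k _; rewrite mod2E mulrDr.
rewrite -mulr_sumr; apply: ler_wpM2l => //.
rewrite exchange_big /=.
(* The contraction [X] is applied to each vector [w k] separately; afterwards the sum over [k] at a
   fixed column [j] produces the factor [Q]. *)
apply: (@le_trans _ _ (\sum_(k < r) lam k * \sum_(j < N | inV (nC G) j)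
   mod2 (w k j))).
  apply: ler_sum => k _; rewrite -mulr_sumr; apply: ler_wpM2l; first exact: lam0.
  exact: contractionP.
under eq_bigr do rewrite mulr_sumr; rewrite exchange_big /=.
apply: (@le_trans _ _ (\sum_(j < N | inV (nC G) j) Q * mod2 (v j))).
  apply: ler_sum => j jC.
  under eq_bigr do rewrite mod2Z mulrA.
  by rewrite -mulr_suml ler_wpM2r ?mod2_ge0 ?beQ.
rewrite -mulr_sumr.
by rewrite ler_piMr.
Qed.

End UpperBound.

(** * Lower bound from a test matrix *)

Section Spread.
Variables (R : realType) (n : nat) (f : nat -> nat).
Hypothesis f_inj : forall i i', (i < n)%N -> (i' < n)%N -> f i = f i' -> i = i'.

(** Pushforward along [f], zero off the image: it carries data of the small graph to the vertices of
    [G], whether finite or not. *)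
Definition spread (t : nat -> R) (a : nat) : R :=
  \sum_(i < n) (f i == a)%:R * t i.

Lemma spread_at t i : (i < n)%N -> spread t (f i) = t i.
Proof.
move=> i_n; rewrite /spread (bigD1 (Ordinal i_n)) //= eqxx mul1r big1 ?addr0 //.
move=> j; apply: contraNeq; rewrite mulf_eq0 negb_or pnatr_eq0 eqb0 negbK.
by case/andP=> /eqP /(f_inj (ltn_ord j) i_n) ji _; apply/eqP/val_inj.
Qed.

Lemma sum_spread t (M : nat) (P : pred nat) (F : nat -> R) :
  (forall i, (i < n)%N -> (f i < M)%N && P (f i)) ->
  \sum_(a < M | P a) spread t a * F a = \sum_(i < n) t i * F (f i).
Proof.
move=> fM; rewrite /spread; under eq_bigr do rewrite mulr_suml.
rewrite exchange_big /=; apply: eq_bigr => i _.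
have /andP[fiM Pfi] := fM i (ltn_ord i).
rewrite (bigD1 (Ordinal fiM)) //= eqxx mul1r big1 ?addr0 //.
move=> a /andP[_]; apply: contraNeq; rewrite !mulf_eq0 !negb_or pnatr_eq0.
by rewrite eqb0 negbK => /andP[/andP[/eqP fa _] _]; apply/eqP/val_inj.
Qed.

(** Gathering is the adjoint of [spread]. As [f] is injective, each [y a] is counted at most once;
    indices [f i] beyond the cut-off contribute 0. *)
Lemma sum_gather_sqr (M : nat) (P : pred nat) (y : nat -> R) :
  \sum_(i < n) (\sum_(a < M | P a) (f i == a)%:R * y a) ^+ 2 <=
  \sum_(a < M | P a) y a ^+ 2.
Proof.
have gatherE (F : nat -> R) i : \sum_(a < M | P a) (f i == a)%:R * F a =
    ((f i < M)%N && P (f i))%:R * F (f i).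
  case: (boolP (_ && _)) => [/andP[fiM Pfi]|fi].
    rewrite (bigD1 (Ordinal fiM)) //= eqxx big1 ?addr0 //.
    move=> a /andP[_]; apply: contraNeq; rewrite !mulf_eq0 !negb_or pnatr_eq0.
    by rewrite eqb0 negbK => /andP[/eqP fa _]; apply/eqP/val_inj.
  rewrite mul0r big1 // => a Pa; apply: contraNeq fi.
  rewrite !mulf_eq0 !negb_or pnatr_eq0 eqb0 negbK => /andP[/eqP -> _].
  by rewrite ltn_ord.
apply: (@le_trans _ _ (\sum_(i < n) \sum_(a < M | P a)
    (f i == a)%:R * y a ^+ 2)).
  apply: ler_sum => i _; rewrite gatherE (gatherE (fun a => y a ^+ 2)) exprMn.
  by case: (_ && _); rewrite /= ?mulr1n ?mulr0n ?expr1n ?expr0n /= ?mul0r.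
rewrite exchange_big; apply: ler_sum => a _ /=; rewrite -mulr_suml.
apply: ler_piMl; first exact: sqr_ge0.
have [/existsP[i fi]|/existsPn nf] := boolP [exists i : 'I_n, f i == a :> nat].
  rewrite (bigD1 i) //= (fi) big1 ?addr0 // => j ji.
  case: eqP => // fj; move/eqP: ji; case.
  by apply/val_inj/f_inj => //=; rewrite fj (eqP fi).
by rewrite big1 // => i _; rewrite (negbTE (nf i)).
Qed.

End Spread.

Section LowerBound.
Variables (R : realType) (b : bool) (G : bigraph).
Local Notation K := (Fld R b).

(** Positive semidefiniteness of the block matrix with diagonal blocks D(p) and D(q) and
    off-diagonal blocks [- Z] and its transpose. *)
Definition psd_bilinear n m (p q : nat -> R) (Z : nat -> nat -> R) : Prop :=
  forall u w : nat -> R,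
  2 * \sum_(i < n) \sum_(j < m) u i * Z i j * w j <=
  \sum_(i < n) p i * u i ^+ 2 + \sum_(j < m) q j * w j ^+ 2.

(* The test matrix is X i j = Z i j / sqrt (p i * q j), extended by 0, tested
   on the unit vectors proportional to sqrt p and sqrt q. *)
Lemma schur_norm_ge_straight n m (H : nat -> nat -> bool) (f g : nat -> nat)
    (p q : nat -> R) (Z : nat -> nat -> R) (c : R) :
  emb_ok (Some n) (nR G) f -> emb_ok (Some m) (nC G) g ->
  (forall i j, (i < n)%N -> (j < m)%N -> H i j = edge G (f i) (g j)) ->
  (0 < n)%N -> (0 < m)%N ->
  (forall i, (i < n)%N -> 0 < p i) -> (forall j, (j < m)%N -> 0 < q j) ->
  psd_bilinear n m p q Z ->
  0 <= \sum_(i < n) \sum_(j < m) (H i j)%:R * Z i j ->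
  c ^+ 2 * ((\sum_(i < n) p i) * (\sum_(j < m) q j)) <=
    (\sum_(i < n) \sum_(j < m) (H i j)%:R * Z i j) ^+ 2 ->
  (c%:E <= schur_norm R b G)%E.
Proof.
move=> [fV f_inj] [gV g_inj] HG n0 m0 p0 q0 psd.
set z := (X in 0 <= X -> _); set P := \sum_(i < n) p i.
set Q := \sum_(j < m) q j => z0 zc.
have P0 : 0 < P.
  rewrite /P (bigD1 (Ordinal n0)) //= ltr_pwDl ?p0 // sumr_ge0 // => i _.
  by rewrite ltW ?p0.
have Q0 : 0 < Q.
  rewrite /Q (bigD1 (Ordinal m0)) //= ltr_pwDl ?q0 // sumr_ge0 // => i _.
  by rewrite ltW ?q0.
pose x i j := Z i j / (Num.sqrt (p i) * Num.sqrt (q j)).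
pose Xr a e := spread n f (fun i => spread m g (x i) e) a.
pose X a e := scal b (Xr a e).
have X1 : (opnorm (nR G) (nC G) X <= 1%:E)%E.
  apply: opnorm_le => // M N v v1; rewrite expr1n; apply: le_trans v1.
  have part (h : K -> R) : (forall I (s : seq I) (pr : pred I) (F : I -> K),
    h (\sum_(i <- s | pr i) F i) = \sum_(i <- s | pr i) h (F i)) ->
    (forall a z, h (scal b a * z) = a * h z) ->
    \sum_(i < M | inV (nR G) i)
       h (\sum_(j < N | inV (nC G) j) X i j * v j) ^+ 2 <=
    \sum_(j < N | inV (nC G) j) h (v j) ^+ 2.
    move=> hsum hZ.
    (* Testing the hypothesis on the image [y] itself, read back through [f] as [u], gives 2 |y|^2
       <= |u|^2 + |w|^2 <= |y|^2 + |h v|^2, and |y|^2 cancels. *)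
    pose y a := h (\sum_(j < N | inV (nC G) j) X a j * v j).
    pose u i := \sum_(a < M | inV (nR G) a) (f i == a)%:R * y a.
    pose w j := \sum_(e < N | inV (nC G) e) (g j == e)%:R * h (v e).
    have yE a : y a = \sum_(i < n) (f i == a)%:R * \sum_(j < m) x i j * w j.
      rewrite /y hsum.
      under eq_bigr do rewrite hZ /Xr /spread mulr_suml.
      rewrite exchange_big; apply: eq_bigr => i _ /=.
      under eq_bigr do rewrite -mulrA.
      rewrite -mulr_sumr; congr (_ * _).
      under [LHS]eq_bigr do rewrite mulr_suml.
      rewrite exchange_big; apply: eq_bigr => j _ /=.
      by rewrite /w mulr_sumr; apply: eq_bigr => e _; ring.
    have yy : \sum_(a < M | inV (nR G) a) y a ^+ 2 =
        \sum_(i < n) \sum_(j < m) u i * x i j * w j.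
      transitivity (\sum_(i < n) u i * \sum_(j < m) x i j * w j); last first.
        by apply: eq_bigr => i _; rewrite mulr_sumr; apply: eq_bigr => j _; ring.
      under eq_bigr => a _ do rewrite expr2 {2}yE mulr_sumr.
      rewrite exchange_big; apply: eq_bigr => i _ /=.
      by rewrite /u mulr_suml; apply: eq_bigr => a _; ring.
    have := psd (fun i => u i / Num.sqrt (p i)) (fun j => w j / Num.sqrt (q j)).
    have -> : \sum_(i < n) \sum_(j < m)
        u i / Num.sqrt (p i) * Z i j * (w j / Num.sqrt (q j)) =
        \sum_(a < M | inV (nR G) a) y a ^+ 2.
      rewrite yy; apply: eq_bigr => i _; apply: eq_bigr => j _.
      by rewrite /x invfM; ring.
    have -> : \sum_(i < n) p i * (u i / Num.sqrt (p i)) ^+ 2 =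
        \sum_(i < n) u i ^+ 2.
      apply: eq_bigr => i _; have pi0 := p0 i (ltn_ord i).
      by rewrite exprMn exprVn sqr_sqrtr ?ltW // mulrC divfK // gt_eqF.
    have -> : \sum_(j < m) q j * (w j / Num.sqrt (q j)) ^+ 2 =
        \sum_(j < m) w j ^+ 2.
      apply: eq_bigr => j _; have qj0 := q0 j (ltn_ord j).
      by rewrite exprMn exprVn sqr_sqrtr ?ltW // mulrC divfK // gt_eqF.
    have := @sum_gather_sqr R n f f_inj M (inV (nR G)) y.
    have := @sum_gather_sqr R m g g_inj N (inV (nC G)) (fun e => h (v e)).
    rewrite -/(y _); set a1 := \sum_(i < M | _) _; set a2 := \sum_(j < N | _) _.
    move=> h1 h2 h3; have : 2 * a1 <= a1 + a2 by apply: le_trans h3 (lerD h2 h1).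
    by rewrite mulrDl mul1r lerD2l.
  have := lerD (part _ (@repart_sum R b) (@repartZ R b))
               (part _ (@impart_sum R b) (@impartZ R b)).
  rewrite -!big_split /=.
  under eq_bigr do rewrite -mod2E; under [X in _ <= X]eq_bigr do rewrite -mod2E.
  by [].
apply: (@le_trans _ _ (opnorm (nR G) (nC G) (schurM G X))); last first.
  by apply: ereal_sup_ubound; exists X.
pose M := (\max_(i < n) f i).+1; pose N := (\max_(j < m) g j).+1.
have fM i : (i < n)%N -> (f i < M)%N && inV (nR G) (f i).
  by move=> i_n; rewrite fV // andbT ltnS (leq_bigmax (Ordinal i_n)).
have gN j : (j < m)%N -> (g j < N)%N && inV (nC G) (g j).
  by move=> j_m; rewrite gV // andbT ltnS (leq_bigmax (Ordinal j_m)).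
pose t0 i := Num.sqrt (p i) / Num.sqrt P.
pose v0 j := Num.sqrt (q j) / Num.sqrt Q.
pose v e := spread m g v0 e.
pose y a := \sum_(e < N | inV (nC G) e) v e * ((edge G a e)%:R * Xr a e).
have t1 : \sum_(a < M | inV (nR G) a) spread n f t0 a ^+ 2 = 1.
  under eq_bigr do rewrite expr2.
  rewrite (sum_spread t0 (spread n f t0) fM) -[RHS](divff (lt0r_neq0 P0)) mulr_suml.
  apply: eq_bigr => i _; rewrite spread_at // -expr2 exprMn exprVn.
  by rewrite !sqr_sqrtr // ltW // p0.
have v1 : \sum_(e < N | inV (nC G) e) v e ^+ 2 = 1.
  under eq_bigr do rewrite expr2.
  rewrite (sum_spread v0 v gN) -[RHS](divff (lt0r_neq0 Q0)) mulr_suml.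
  apply: eq_bigr => j _; rewrite ?/v spread_at // -expr2 exprMn exprVn.
  by rewrite !sqr_sqrtr // ltW // q0.
have tyE : \sum_(a < M | inV (nR G) a) spread n f t0 a * y a =
    z / (Num.sqrt P * Num.sqrt Q).
  rewrite (sum_spread _ _ fM) /z mulr_suml; apply: eq_bigr => i _.
  rewrite /y (sum_spread v0 (fun e => (edge G (f i) e)%:R * Xr (f i) e) gN).
  rewrite mulr_sumr mulr_suml; apply: eq_bigr => j _.
  rewrite -HG // /Xr !spread_at // /t0 /v0 /x.
  have pi0 : Num.sqrt (p i) != 0 by rewrite sqrtr_eq0 -ltNge p0.
  have qj0 : Num.sqrt (q j) != 0 by rewrite sqrtr_eq0 -ltNge q0.
  have PP0 : Num.sqrt P != 0 by rewrite sqrtr_eq0 -ltNge.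
  have QQ0 : Num.sqrt Q != 0 by rewrite sqrtr_eq0 -ltNge.
  by field; rewrite pi0 qj0 PP0 QQ0.
apply: (@le_opnorm _ _ _ _ _ _ M N (fun e => scal b (v e))).
  by under eq_bigr do rewrite mod2_scal; rewrite v1.
apply: (@le_trans _ _ (\sum_(a < M | inV (nR G) a) y a ^+ 2)); last first.
  apply: ler_sum => a _; rewrite mod2E ler_wpDr ?sqr_ge0 //.
  apply: ler_eq; congr (_ ^+ 2); rewrite repart_sum; apply: eq_bigr => e _.
  rewrite /schurM; case: ifP => _; last by rewrite !mul0r repart0 mulr0.
  by rewrite mul1r /X repartZ repart_scal mulrC.
(* Pairing [y] with the unit vector [spread n f t0] bounds its norm below by
   [z / (Num.sqrt P * Num.sqrt Q)]. *)
have := @wgt_cauchy_schwarz R 'I_M (index_enum 'I_M) (fun a => inV (nR G) a)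
  (fun => 1) (fun a => spread n f t0 a) (fun a => y a) (fun _ _ => ler01).
under eq_bigr do rewrite mul1r; under [X in _ <= X * _]eq_bigr do rewrite mul1r.
under [X in _ <= _ * X]eq_bigr do rewrite mul1r.
rewrite tyE t1 mul1r; apply: le_trans.
rewrite exprMn exprVn exprMn (sqr_sqrtr (ltW P0)) (sqr_sqrtr (ltW Q0)).
by rewrite ler_pdivlMr // mulr_gt0.
Qed.

(** Lets an embedding that swaps the sides use the same test data. *)
Lemma psd_bilinear_tr n m p q Z :
  psd_bilinear n m p q Z -> psd_bilinear m n q p (fun j i => Z i j).
Proof.
move=> psd u w; rewrite addrC exchange_big /=; apply: le_trans (psd w u).
apply: ler_eq; congr (_ * _); apply: eq_bigr => i _; apply: eq_bigr => j _.
ring.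
Qed.

Lemma schur_norm_ge n m (H : bigraph) (p q : nat -> R) (Z : nat -> nat -> R)
    (c : R) :
  ind_le H G -> nR H = Some n -> nC H = Some m -> (0 < n)%N -> (0 < m)%N ->
  (forall i, (i < n)%N -> 0 < p i) -> (forall j, (j < m)%N -> 0 < q j) ->
  psd_bilinear n m p q Z ->
  0 <= \sum_(i < n) \sum_(j < m) (edge H i j)%:R * Z i j ->
  c ^+ 2 * ((\sum_(i < n) p i) * (\sum_(j < m) q j)) <=
    (\sum_(i < n) \sum_(j < m) (edge H i j)%:R * Z i j) ^+ 2 ->
  (c%:E <= schur_norm R b G)%E.
Proof.
move=> [f [g]] + nRH nCH n0 m0 p0 q0 psd z0 zc; rewrite nRH nCH /=.
case=> -[fV [gV HG]].
  exact: (schur_norm_ge_straight fV gV HG n0 m0 p0 q0 psd z0 zc).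
apply: (schur_norm_ge_straight gV fV _ m0 n0 q0 p0 (psd_bilinear_tr psd)).
- by move=> j i jm i_n; exact: (esym (esym (HG i j i_n jm))).
- by rewrite exchange_big.
- by rewrite [_ * \sum_(_ < n) _]mulrC exchange_big.
Qed.

(* Diagonal dominance makes these weights q admissible for Z i j = p i * y i j. *)
Definition dom_wgt n m (p : nat -> R) (y : nat -> nat -> R) (j : nat) : R :=
  \sum_(k < m) `|\sum_(i < n) p i * (y i j * y i k)|.

(** With s = y w, the inequality 2 u s <= u^2 + s^2 leaves the quadratic form of y^T D(p) y, which
    is bounded by its absolute row sums as in Gershgorin's theorem. The second step loses nothing
    when the columns of [y] are orthogonal for the weights [p]. *)
Lemma psd_dom_wgt n m p y : (forall i, (i < n)%N -> 0 < p i) ->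
  psd_bilinear n m p (dom_wgt n m p y) (fun i j => p i * y i j).
Proof.
move=> p0 u w; pose s i := \sum_(j < m) y i j * w j.
pose r j k := \sum_(i < n) p i * (y i j * y i k).
have step1 : 2 * \sum_(i < n) \sum_(j < m) u i * (p i * y i j) * w j <=
    \sum_(i < n) p i * u i ^+ 2 + \sum_(i < n) p i * s i ^+ 2.
  rewrite mulr_sumr -big_split /=; apply: ler_sum => i _.
  have -> : \sum_(j < m) u i * (p i * y i j) * w j = u i * p i * s i.
    by rewrite /s mulr_sumr; apply: eq_bigr => j _; ring.
  rewrite -subr_ge0; set X := (X in 0 <= X).
  have -> : X = p i * (u i - s i) ^+ 2 by rewrite /X; ring.
  by rewrite mulr_ge0 ?sqr_ge0 // ltW // p0.
apply: le_trans step1 _; rewrite lerD2l.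
have -> : \sum_(i < n) p i * s i ^+ 2 =
    \sum_(j < m) \sum_(k < m) r j k * (w j * w k).
  transitivity (\sum_(i < n) \sum_(j < m) \sum_(k < m)
      p i * (y i j * y i k) * (w j * w k)).
    apply: eq_bigr => i _; rewrite expr2 {1}/s mulr_suml mulr_sumr.
    apply: eq_bigr => j _; rewrite /s !mulr_sumr.
    by apply: eq_bigr => k _; ring.
  rewrite exchange_big; apply: eq_bigr => j _ /=.
  by rewrite exchange_big; apply: eq_bigr => k _ /=; rewrite /r mulr_suml.
have rC j k : r j k = r k j by apply: eq_bigr => i _; rewrite [y i k * _]mulrC.
rewrite -(ler_pM2l (ltr0n R 2)).
apply: (@le_trans _ _ (\sum_(j < m) \sum_(k < m) `|r j k| * (w j ^+ 2 + w k ^+ 2))).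
  rewrite mulr_sumr; apply: ler_sum => j _; rewrite mulr_sumr.
  apply: ler_sum => k _; have h1 := ler_norm (r j k).
  have h2 : - r j k <= `|r j k| by rewrite -normrN ler_norm.
  have := mulr_ge0 (_ : 0 <= `|r j k| - r j k) (sqr_ge0 (w j + w k)).
  (* The two products add up to twice |r| (w_j^2 + w_k^2) - 2 r w_j w_k. *)
  have := mulr_ge0 (_ : 0 <= `|r j k| + r j k) (sqr_ge0 (w j - w k)).
  move=> /(_ ltac:(lra)) h3 /(_ ltac:(lra)) h4; nra.
under eq_bigr do (under eq_bigr do rewrite mulrDr; rewrite big_split /=).
rewrite big_split /= [X in _ + X]exchange_big /=.
under [X in _ + X]eq_bigr do under eq_bigr do rewrite rC.
rewrite mulrDl mul1r; apply: ler_eq.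
by congr (_ + _); apply: eq_bigr => j _; rewrite /dom_wgt mulr_suml.
Qed.

End LowerBound.

(** * Exact arithmetic in quadratic rings *)

Section QuadraticIntegers.
Variable d : Z.

(* (a, b) stands for a + b * sqrt d. *)
Definition quad := (Z * Z)%type.

Definition quad0 : quad := (Z0, Z0).
Definition quad_int (z : Z) : quad := (z, Z0).
Definition quad_add (x y : quad) : quad := (Z.add x.1 y.1, Z.add x.2 y.2).
Definition quad_opp (x : quad) : quad := (Z.opp x.1, Z.opp x.2).
Definition quad_mul (x y : quad) : quad :=
  (Z.add (Z.mul x.1 y.1) (Z.mul d (Z.mul x.2 y.2)),
   Z.add (Z.mul x.1 y.2) (Z.mul x.2 y.1)).
Definition quad_sum (n : nat) (f : nat -> quad) : quad :=
  foldr (fun i s => quad_add (f i) s) quad0 (iota 0 n).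
(** An exact sign test in integers: when the two parts have opposite signs, the square of the first
    is compared with [d] times the square of the second. *)
Definition quad_nneg (x : quad) : bool :=
  if Z.leb 0 x.1 then
    Z.leb 0 x.2 || Z.leb (Z.mul d (Z.mul x.2 x.2)) (Z.mul x.1 x.1)
  else
    Z.leb 0 x.2 && Z.leb (Z.mul x.1 x.1) (Z.mul d (Z.mul x.2 x.2)).
Definition quad_le (x y : quad) : bool := quad_nneg (quad_add y (quad_opp x)).
Definition quad_pos (x : quad) : bool := ~~ quad_nneg (quad_opp x).
Definition quad_abs (x : quad) : quad := if quad_nneg x then x else quad_opp x.

Variable R : realType.

Definition zr (z : Z) : R := (int_of_Z z)%:~R.
Definition qev (x : quad) : R := zr x.1 + zr x.2 * Num.sqrt (zr d).

Lemma zrD x y : zr (Z.add x y) = zr x + zr y.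
Proof. by rewrite /zr -rmorphD -(rmorphD int_of_Z). Qed.

Lemma zrM x y : zr (Z.mul x y) = zr x * zr y.
Proof. by rewrite /zr -rmorphM -(rmorphM int_of_Z). Qed.

Lemma zrN x : zr (Z.opp x) = - zr x.
Proof. by rewrite /zr -rmorphN -(rmorphN int_of_Z). Qed.

Lemma zr0 : zr Z0 = 0.
Proof. by []. Qed.

Lemma zr_nat (k : nat) : zr (Z.of_nat k) = k%:R.
Proof. by rewrite /zr; have -> : int_of_Z (Z.of_nat k) = k by lia. Qed.

Lemma zr_le x y : (zr x <= zr y) = Z.leb x y.
Proof. by rewrite ler_int; lia. Qed.

Lemma zr_lt x y : (zr x < zr y) = Z.ltb x y.
Proof. by rewrite ltr_int; lia. Qed.

Hypothesis d_ge0 : Z.leb 0 d.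

Lemma sqr_sqrt_d : Num.sqrt (zr d) ^+ 2 = zr d.
Proof. by rewrite sqr_sqrtr // -zr0 zr_le. Qed.

Lemma qev0 : qev quad0 = 0.
Proof. by rewrite /qev !zr0 mul0r addr0. Qed.

Lemma qev_int z : qev (quad_int z) = zr z.
Proof. by rewrite /qev zr0 mul0r addr0. Qed.

Lemma qevD x y : qev (quad_add x y) = qev x + qev y.
Proof. by rewrite /qev !zrD; ring. Qed.

Lemma qevN x : qev (quad_opp x) = - qev x.
Proof. by rewrite /qev !zrN; ring. Qed.

Lemma qevM x y : qev (quad_mul x y) = qev x * qev y.
Proof.
rewrite /qev !zrD !zrM; have := sqr_sqrt_d; move: (Num.sqrt _) => s <-.
ring.
Qed.

Lemma qev_sum n f : qev (quad_sum n f) = \sum_(i < n) qev (f i).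
Proof.
rewrite -(big_mkord xpredT (fun i => qev (f i))) /index_iota subn0 /quad_sum.
by elim: (iota 0 n) => [|i s IH]; rewrite ?big_nil ?qev0 // big_cons /= qevD IH.
Qed.

Lemma quad_nnegE x : quad_nneg x = (0 <= qev x).
Proof.
case: x => a b; rewrite /quad_nneg /qev /= -!zr_le !zrM zr0.
have := sqr_sqrt_d; have := sqrtr_ge0 (zr d).
move: (Num.sqrt _) (zr a) (zr b) => s x y s0 <-.
have -> : s ^+ 2 * (y * y) = (y * s) ^+ 2 by ring.
rewrite -expr2; have [x0|x0] := leP 0 x; have [y0|y0] /= := leP 0 y.
- by rewrite addr_ge0 // mulr_ge0.
- rewrite -sqrrN ler_pXn2r ?nnegrE //; last first.
    by rewrite -mulNr mulr_ge0 // oppr_ge0 ltW.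
  by apply/idP/idP; lra.
- rewrite -sqrrN ler_pXn2r // ?nnegrE ?oppr_ge0; [|exact: ltW|exact: mulr_ge0].
  by apply/idP/idP; lra.
- apply/esym/negbTE; rewrite -ltNge.
  have : y * s <= 0 by rewrite mulr_le0_ge0 // ltW.
  lra.
Qed.

Lemma quad_leE x y : quad_le x y = (qev x <= qev y).
Proof. by rewrite /quad_le quad_nnegE qevD qevN subr_ge0. Qed.

Lemma quad_posE x : quad_pos x = (0 < qev x).
Proof. by rewrite /quad_pos quad_nnegE qevN oppr_ge0 -ltNge. Qed.

Lemma qev_abs x : qev (quad_abs x) = `|qev x|.
Proof.
rewrite /quad_abs quad_nnegE; case: leP => x0; first by rewrite ger0_norm.
by rewrite qevN ltr0_norm.
Qed.

End QuadraticIntegers.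

(** * Certificates for the two bounds and their soundness *)

Definition ent (rows : seq (seq nat)) (i j : nat) : bool :=
  nth 0%N (nth [::] rows i) j == 1%N.
Definition ncols (rows : seq (seq nat)) : nat := size (head [::] rows).

Lemma edge_mxg rows i j : (i < size rows)%N -> (j < ncols rows)%N ->
  edge (mxg rows) i j = ent rows i j.
Proof. by rewrite /edge /= => -> ->. Qed.

Definition all_below (n : nat) (P : pred nat) : bool := all P (iota 0 n).

Lemma all_belowP n (P : pred nat) i : all_below n P -> (i < n)%N -> P i.
Proof. by move/allP=> H i_n; apply: H; rewrite mem_iota. Qed.

Definition vget (s : seq quad) (i : nat) : quad := nth quad0 s i.
Definition mget (s : seq (seq quad)) (i j : nat) : quad := vget (nth [::] s i) j.

Section Certificates.
Variables (d : Z) (rows : seq (seq nat)) (e : quad) (N : Z).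
Local Notation "x * y" := (quad_mul d x y).
Local Notation n := (size rows).
Local Notation m := (ncols rows).

Definition low_wgt (p : seq quad) (y : seq (seq quad)) (j : nat) : quad :=
  quad_sum m (fun k => quad_abs d
    (quad_sum n (fun i => vget p i * (mget y i j * mget y i k)))).

Definition low_val (p : seq quad) (y : seq (seq quad)) : quad :=
  quad_sum n (fun i => quad_sum m (fun j =>
    if ent rows i j then vget p i * mget y i j else quad0)).

(** [e / N] is the square of the claimed lower bound. The weights [q] are computed by [low_wgt], so
    semidefiniteness needs no check of its own. *)
Definition low_check (p : seq quad) (y : seq (seq quad)) : bool :=
  [&& Z.leb 0 d, Z.ltb 0 N, (0 < n)%N, (0 < m)%N,
      all_below n (fun i => quad_pos d (vget p i)),
      all_below m (fun j => quad_pos d (low_wgt p y j)),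
      quad_nneg d (low_val p y) &
      quad_le d (e * (quad_sum n (vget p) * quad_sum m (low_wgt p y)))
                (quad_int N * (low_val p y * low_val p y))].

(** [D] clears denominators: the weighted Gram sums are [D] times the 0/1 entries, and [P / D],
    [Q / D] bound the squared norms. *)
Definition up_check (D : Z) (P Q : quad) (lam : seq quad)
    (al be : seq (seq quad)) : bool :=
  let r := size lam in
  [&& Z.leb 0 d, Z.ltb 0 N, Z.ltb 0 D, quad_nneg d P, quad_nneg d Q,
      all_below r (fun k => quad_nneg d (vget lam k)),
      all_below n (fun i => all_below m (fun j =>
        quad_sum r (fun k => vget lam k * (mget al i k * mget be j k)) ==
        if ent rows i j then quad_int D else quad0)),
      all_below n (fun i => quad_le d
        (quad_sum r (fun k => vget lam k * (mget al i k * mget al i k))) P),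
      all_below m (fun j => quad_le d
        (quad_sum r (fun k => vget lam k * (mget be j k * mget be j k))) Q) &
      quad_le d (quad_int N * (P * Q)) (e * (quad_int D * quad_int D))].

End Certificates.

Section CertificateSoundness.
Variables (R : realType) (b : bool) (G : bigraph).
Variables (d : Z) (rows : seq (seq nat)) (e : quad) (N : Z) (c : R).
Hypothesis cE : c ^+ 2 * zr R N = qev d R e.

Lemma low_checkP p y : low_check d rows e N p y -> ind_le (mxg rows) G ->
  (c%:E <= schur_norm R b G)%E.
Proof.
case/and5P=> d0 N0 n0 m0 /and4P[/all_belowP p0 /all_belowP q0 z0 zc] rG.
pose pr i := qev d R (vget p i); pose yr i j := qev d R (mget y i j).
have wE j : qev d R (low_wgt d rows p y j) =
    dom_wgt (size rows) (ncols rows) pr yr j.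
  rewrite qev_sum //; apply: eq_bigr => k _; rewrite qev_abs // qev_sum //.
  by congr `|_|; apply: eq_bigr => i _; rewrite !qevM.
have zE : qev d R (low_val d rows p y) = \sum_(i < size rows)
    \sum_(j < ncols rows) (edge (mxg rows) i j)%:R * (pr i * yr i j).
  rewrite qev_sum //; apply: eq_bigr => i _; rewrite qev_sum //.
  apply: eq_bigr => j _; rewrite edge_mxg //.
  by case: ifP; rewrite ?mul0r ?mul1r ?qev0 // qevM.
have pr0 i : (i < size rows)%N -> 0 < pr i.
  by move/p0; rewrite (quad_posE R).
have psd := @psd_dom_wgt R (size rows) (ncols rows) pr yr pr0.
apply: (schur_norm_ge b rG (erefl _) (erefl _) n0 m0 pr0 _ psd).
- by move=> j /q0; rewrite (quad_posE R) // wE.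
- by rewrite -zE -quad_nnegE.
- rewrite -zE; move: zc; rewrite (quad_leE R) // !qevM // qev_int -cE.
  move: (qev d R (low_val _ _ _ _)) => z; rewrite !qev_sum //.
  rewrite [X in _ * (_ * X)](_ : _ = \sum_(j < ncols rows)
     dom_wgt (size rows) (ncols rows) pr yr j); last exact: eq_bigr.
  have N0r : 0 < zr R N by rewrite -zr0 zr_lt.
  by rewrite -expr2 [c ^+ 2 * zr R N]mulrC -mulrA ler_pM2l.
Qed.

Lemma up_checkP D P Q lam al be : 0 <= c ->
  up_check d rows e N D P Q lam al be -> ind_le G (mxg rows) ->
  (schur_norm R b G <= c%:E)%E.
Proof.
move=> c0; rewrite /up_check; case/and5P=> d0 N0 D0 P0 /and5P[Q0 l0 eqM alP].
case/andP=> beQ PQ.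
have D0r : 0 < zr R D by rewrite -zr0 zr_lt.
have N0r : 0 < zr R N by rewrite -zr0 zr_lt.
pose lr k := qev d R (vget lam k) / zr R D.
pose ar i k := qev d R (mget al i k); pose br j k := qev d R (mget be j k).
pose Pr := qev d R P / zr R D; pose Qr := qev d R Q / zr R D.
have sumE (x y : nat -> nat -> quad) i j :
    \sum_(k < size lam) lr k * (qev d R (x i k) * qev d R (y j k)) =
    qev d R (quad_sum (size lam) (fun k =>
      quad_mul d (vget lam k) (quad_mul d (x i k) (y j k)))) / zr R D.
  rewrite qev_sum // mulr_suml; apply: eq_bigr => k _.
  by rewrite !qevM // /lr mulrAC.
have lr0 k : (k < size lam)%N -> 0 <= lr k.
  by move=> /(all_belowP l0); rewrite (quad_nnegE R) // => ?; rewrite divr_ge0 // ltW.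
have Pr0 : 0 <= Pr by rewrite divr_ge0 ?(ltW D0r) // -quad_nnegE.
have Qr0 : 0 <= Qr by rewrite divr_ge0 ?(ltW D0r) // -quad_nnegE.
have PQr : Pr * Qr <= c ^+ 2.
  move: PQ; rewrite (quad_leE R) // !qevM // !qev_int -cE => PQ.
  rewrite /Pr /Qr mulrACA -invfM ler_pdivrMr ?mulr_gt0 //.
  by rewrite -(ler_pM2l N0r) [X in _ <= X]mulrA [zr R N * c ^+ 2]mulrC.
have eqMr i j : (i < size rows)%N -> (j < ncols rows)%N ->
    \sum_(k < size lam) lr k * (ar i k * br j k) = (edge (mxg rows) i j)%:R.
  move=> i_n j_m; rewrite sumE (eqP (all_belowP (all_belowP eqM i_n) j_m)).
  rewrite edge_mxg //; case: ifP => _; first by rewrite qev_int divff ?gt_eqF.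
  by rewrite qev0 mul0r.
have alPr i : (i < size rows)%N -> \sum_(k < size lam) lr k * ar i k ^+ 2 <= Pr.
  move=> i_n; under eq_bigr do rewrite expr2.
  by rewrite sumE ler_pM2r ?invr_gt0 // -quad_leE // (all_belowP alP).
have beQr j : (j < ncols rows)%N -> \sum_(k < size lam) lr k * br j k ^+ 2 <= Qr.
  move=> j_m; under eq_bigr do rewrite expr2.
  by rewrite sumE ler_pM2r ?invr_gt0 // -quad_leE // (all_belowP beQ).
case=> f [g] [[[fV _] [[gV _] GF]]|[[fV _] [[gV _] GF]]].
  apply: (schur_norm_le_gram b (al := fun i => ar (f i)) (be := fun j => br (g j))
    lr0 Pr0 Qr0 c0 PQr) => [i j iR jC|i iR|j jC].
  - by rewrite eqMr ?GF //; [exact: fV|exact: gV].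
  - by apply: alPr; exact: fV.
  - by apply: beQr; exact: gV.
(* When the embedding swaps the sides, the two families of vectors and their bounds change
   places. *)
apply: (schur_norm_le_gram b (al := fun i => br (f i)) (be := fun j => ar (g j))
    lr0 Qr0 Pr0 c0) => [|i j iR jC|i iR|j jC].
- by rewrite mulrC.
- under eq_bigr do rewrite [br _ _ * _]mulrC.
  by rewrite eqMr ?GF //; [exact: gV|exact: fV].
- by apply: beQr; exact: fV.
- by apply: alPr; exact: gV.
Qed.

End CertificateSoundness.

(** * The constants and their certificates *)

Section EtaTables.
Local Open Scope Z_scope.

(* eta_k ^ 2 = eta_num k / eta_den k, where eta_num k lives in
   Z[sqrt (eta_disc k)]. *)
Definition eta_disc (k : nat) : Z :=
  match k with 4%nat => 19 | 6%nat => 5 | _ => 2 end.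

Definition eta_num (k : nat) : quad :=
  match k with
  | 1%nat => (1, 0) | 2%nat => (4, 0) | 3%nat => (3, 2)
  | 4%nat => (169, 38) | 5%nat => (3, 0) | 6%nat => (20, 8) | _ => (0, 0)
  end.

Definition eta_den (k : nat) : Z :=
  match k with
  | 2%nat => 3 | 3%nat => 4 | 4%nat => 225 | 5%nat => 2 | 6%nat => 25 | _ => 1
  end.

End EtaTables.

Section Eta.
Variable R : realType.
Local Notation eta k := (eta_k R k).

Lemma sqrt_prop n : Num.sqrt (n%:R : R) ^+ 2 = n%:R.
Proof. exact: sqr_sqrtr (ler0n _ _). Qed.

Lemma eta_sqr k : (0 < k <= 6)%N ->
  eta k ^+ 2 * zr R (eta_den k) = qev (eta_disc k) R (eta_num k).
Proof.
have s2 := sqrt_prop 2; have s5 := sqrt_prop 5; have s19 := sqrt_prop 19.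
have p5 := sqrtr_ge0 (5%:R : R); have p19 := sqrtr_ge0 (19%:R : R).
rewrite /qev; case: k => [|[|[|[|[|[|[|k]]]]]]] //= _.
- rewrite (zr_nat R 0) (zr_nat R 1); lra.
- rewrite (zr_nat R 0) (zr_nat R 3) (zr_nat R 4) sqr_sqrtr; lra.
- rewrite (zr_nat R 2) (zr_nat R 3) (zr_nat R 4); move: s2; set s := Num.sqrt _ => s2.
  nra.
- rewrite (zr_nat R 225) (zr_nat R 38) (zr_nat R 169) (zr_nat R 19) exprMn sqr_sqrtr; lra.
- rewrite (zr_nat R 0) (zr_nat R 3) (zr_nat R 2) sqr_sqrtr; lra.
- rewrite (zr_nat R 25) (zr_nat R 20) (zr_nat R 8) (zr_nat R 5) exprMn sqr_sqrtr; lra.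
Qed.

Lemma eta_ge0 k : 0 <= eta k.
Proof.
by case: k => [|[|[|[|[|[|[|k]]]]]]] //=;
  rewrite ?mulr_ge0 ?invr_ge0 ?addr_ge0 ?sqrtr_ge0.
Qed.

Lemma eta_sqr_lt j : (j < 6)%N -> eta j ^+ 2 < eta j.+1 ^+ 2.
Proof.
have s2 := sqrt_prop 2; have s5 := sqrt_prop 5; have s19 := sqrt_prop 19.
have p2 := sqrtr_ge0 (2%:R : R).
have p5 := sqrtr_ge0 (5%:R : R); have p19 := sqrtr_ge0 (19%:R : R).
(* The squares are 0, 1, 4/3, then about 1.457 and 1.487, then 3/2 and about 1.516. All gaps exceed
   0.012, so crude bounds on the roots suffice. *)
have e5 : Num.sqrt (5%:R : R) > 22 / 10 by nra.
have e2 : Num.sqrt (2%:R : R) > 14 / 10 by nra.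
have e2' : Num.sqrt (2%:R : R) < 1415 / 1000 by nra.
have e19 : Num.sqrt (19%:R : R) > 435 / 100 by nra.
have e19' : Num.sqrt (19%:R : R) < 436 / 100 by nra.
case: j => [|[|[|[|[|[|j]]]]]] //= _; rewrite ?exprMn
  ?[Num.sqrt (_ + _) ^+ 2]sqr_sqrtr
  ?[Num.sqrt (_ / _) ^+ 2]sqr_sqrtr; lra.
Qed.

Lemma eta_lt j k : (j < k <= 6)%N -> eta j < eta k.
Proof.
case/andP=> jk k6.
suff : eta j ^+ 2 < eta k ^+ 2 by rewrite ltr_pXn2r ?nnegrE ?eta_ge0.
elim: k jk k6 => // k IH; rewrite ltnS leq_eqVlt => /orP[/eqP ->|jk] k6.
  exact: eta_sqr_lt.
exact: lt_trans (IH jk (ltnW k6)) (eta_sqr_lt k6).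
Qed.

End Eta.

Section Certificates.
Local Open Scope Z_scope.

(* For each k: a common denominator D, the squared-norm bounds P and Q, the
   weights and the two families of vectors of a Gram factorisation of the
   matrix of F_k, obtained from the polar part of the optimal test matrix. *)
Definition up_cert (k : nat) :
    Z * quad * quad * seq quad * seq (seq quad) * seq (seq quad) :=
  match k with
  | 1%nat =>
    (1, (1, 0), (1, 0), [:: (1, 0)],
     [:: [:: (1, 0)]],
     [:: [:: (1, 0)]])
  | 2%nat =>
    (12, (16, 0), (12, 0), [:: (1, 0); (3, 0)],
     [:: [:: (4, 0); (0, 0)]; [:: (2, 0); (2, 0)]],
     [:: [:: (3, 0); (-1, 0)]; [:: (3, 0); (1, 0)]; [:: (0, 0); (2, 0)]])
  | 3%nat =>
    (4, (3, 2), (4, 0), [:: (3, 2); (2, 2); (4, 0)],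
     [:: [:: (1, 0); (0, 0); (0, 0)]; [:: (-1, 1); (1, 0); (0, 0)];
         [:: (-1, 1); (1, -1); (1, 0)]; [:: (-3, 2); (2, -1); (1, 0)]],
     [:: [:: (12, -8); (-8, 6); (-3, 2)]; [:: (12, -8); (-6, 4); (-1, 1)];
         [:: (0, 0); (-2, 2); (-1, 1)]; [:: (0, 0); (0, 0); (1, 0)]])
  | 4%nat =>
    (101250, (76050, 17100), (101250, 0),
         [:: (338, 76); (135, 270); (2475, 450)],
     [:: [:: (15, 0); (0, 0); (0, 0)]; [:: (-60, 15); (10, 0); (0, 0)];
         [:: (-25, 5); (5, 0); (5, 0)]],
     [:: [:: (507, -114); (-43, 11); (-31, 7)];
         [:: (0, 0); (-1, 2); (-11, 2)]; [:: (0, 0); (-1, 2); (11, -2)];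
         [:: (507, -114); (-42, 9); (-20, 5)]; [:: (0, 0); (0, 0); (22, -4)]])
  | 5%nat =>
    (72, (108, 0), (72, 0), [:: (3, 0); (1, 0); (8, 0)],
     [:: [:: (6, 0); (0, 0); (0, 0)]; [:: (3, 0); (9, 0); (0, 0)];
         [:: (3, 0); (3, 0); (3, 0)]],
     [:: [:: (4, 0); (4, 0); (1, 0)]; [:: (4, 0); (-4, 0); (-1, 0)];
         [:: (0, 0); (8, 0); (-1, 0)]; [:: (0, 0); (0, 0); (3, 0)]])
  | 6%nat =>
    (800, (640, 256), (800, 0), [:: (40, 16); (5, 5); (25, 15); (200, 0)],
     [:: [:: (4, 0); (0, 0); (0, 0); (0, 0)];
         [:: (6, -2); (8, 0); (0, 0); (0, 0)];
         [:: (4, -2); (4, 0); (4, 0); (0, 0)];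
         [:: (-4, 2); (-6, 2); (-2, 2); (2, 0)]],
     [:: [:: (25, -10); (20, -10); (10, -4); (-3, 1)];
         [:: (25, -10); (15, -5); (15, -7); (-2, 1)];
         [:: (0, 0); (-5, 5); (-5, 3); (2, -1)];
         [:: (0, 0); (0, 0); (-10, 6); (3, -1)];
         [:: (0, 0); (0, 0); (0, 0); (2, 0)]])
  | _ => (0, quad0, quad0, [::], [::], [::])
  end.

(* Weights p and matrix y of a test matrix for E_k; for k = 5 it is the
   transpose of E_5 that is tested, the columns of y being orthogonal. *)
Definition low_cert (k : nat) : seq quad * seq (seq quad) :=
  match k with
  | 1%nat =>
    ([:: (1, 0)],
     [:: [:: (1, 0)]])
  | 2%nat =>
    ([:: (2, 0); (1, 0)],
     [:: [:: (1, 0); (1, 0)]; [:: (-1, 0); (2, 0)]])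
  | 3%nat =>
    ([:: (0, 1); (2, 0); (2, -1)],
     [:: [:: (-1, 1); (2, -1); (-3, 2)]; [:: (-3, 2); (2, -1); (-1, 1)];
         [:: (-1, 1); (-2, 1); (1, 0)]])
  | 4%nat =>
    ([:: (10, -1); (10, 2); (10, -1)],
     [:: [:: (3, 0); (-10, 2); (-5, 1)]; [:: (-12, 3); (27, -6); (-12, 3)];
         [:: (-5, 1); (-10, 2); (3, 0)]])
  | 5%nat =>
    ([:: (5, 0); (1, 0); (1, 0); (1, 0)],
     [:: [:: (1, 0); (1, 0); (1, 0)]; [:: (3, 0); (-1, 0); (-1, 0)];
         [:: (-1, 0); (3, 0); (-1, 0)]; [:: (-1, 0); (-1, 0); (3, 0)]])
  | 6%nat =>
    ([:: (2, 0); (4, 0); (1, 1); (3, -1)],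
     [:: [:: (3, -1); (-1, 1); (4, -2); (-2, 1)];
         [:: (2, -1); (1, 0); (1, 0); (2, -1)];
         [:: (-2, 1); (4, -2); (-1, 1); (3, -1)];
         [:: (-3, 1); (1, 0); (1, -1); (2, 0)]])
  | _ => ([::], [::])
  end.

End Certificates.

(** The checkers and [tr_rows] compute on lists of rows, which [mxg] hides behind an adjacency
    function. *)
Definition E_rows (k : nat) : seq (seq nat) :=
  match k with
  | 1 => [:: [:: 1]]
  | 2 => [:: [:: 1; 1]; [:: 0; 1]]
  | 3 => [:: [:: 1; 1; 0]; [:: 0; 1; 1]; [:: 0; 0; 1]]
  | 4 => [:: [:: 1; 0; 0]; [:: 1; 1; 1]; [:: 0; 0; 1]]
  | 5 => [:: [:: 1; 1; 0; 0]; [:: 1; 0; 1; 0]; [:: 1; 0; 0; 1]]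
  | 6 => [:: [:: 1; 1; 0; 0]; [:: 0; 1; 1; 0]; [:: 0; 0; 1; 1]; [:: 0; 0; 0; 1]]
  | _ => [:: [:: 1]]
  end%N.

Definition F_rows (k : nat) : seq (seq nat) :=
  match k with
  | 1 => [:: [:: 1]]
  | 2 => [:: [:: 1; 1; 0]; [:: 0; 1; 1]]
  | 3 => [:: [:: 1; 1; 0; 0]; [:: 1; 0; 1; 0]; [:: 0; 1; 0; 1];
             [:: 0; 0; 1; 1]]
  | 4 => [:: [:: 1; 0; 0; 1; 0]; [:: 1; 1; 1; 0; 0]; [:: 0; 0; 1; 0; 1]]
  | 5 => [:: [:: 1; 1; 0; 0]; [:: 1; 0; 1; 0]; [:: 1; 0; 0; 1]]
  | 6 => [:: [:: 1; 1; 0; 0; 0]; [:: 0; 1; 1; 0; 0]; [:: 0; 0; 1; 1; 0];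
             [:: 0; 0; 0; 1; 1]]
  | _ => [:: [:: 1]]
  end%N.

Lemma E_rowsE k : E_ k = mxg (E_rows k).
Proof. by do 7 case: k => [|k] //. Qed.

Lemma F_rowsE k : F_ k = mxg (F_rows k).
Proof. by do 7 case: k => [|k] //. Qed.

Definition tr_rows (rows : seq (seq nat)) : seq (seq nat) :=
  mkseq (fun j => mkseq (fun i => nth 0%N (nth [::] rows i) j) (size rows))
    (ncols rows).

Lemma ent_tr rows i j : (i < size rows)%N -> (j < ncols rows)%N ->
  ent (tr_rows rows) j i = ent rows i j.
Proof. by move=> i_n j_m; rewrite /ent nth_mkseq // nth_mkseq. Qed.

Lemma size_tr rows : size (tr_rows rows) = ncols rows.
Proof. by rewrite size_mkseq. Qed.

Lemma ncols_tr rows : (0 < ncols rows)%N -> ncols (tr_rows rows) = size rows.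
Proof. by rewrite {2}/ncols /tr_rows; case: ncols => // m _; rewrite size_mkseq. Qed.

Lemma ind_le_tr rows G : (0 < ncols rows)%N ->
  ind_le (mxg rows) G -> ind_le (mxg (tr_rows rows)) G.
Proof.
move=> m0 [f [g H]]; exists g, f.
have nRt : nR (mxg (tr_rows rows)) = nC (mxg rows) by rewrite /= size_tr.
have nCt : nC (mxg (tr_rows rows)) = nR (mxg rows).
  by rewrite /= -[size (head _ _)]/(ncols _) ncols_tr.
have tE i j : (i < size rows)%N -> (j < ncols rows)%N ->
    edge (mxg (tr_rows rows)) j i = edge (mxg rows) i j.
  by move=> i_n j_m; rewrite !edge_mxg ?ent_tr ?size_tr ?ncols_tr.
rewrite nRt nCt; case: H => -[fV [gV H]]; [right|left]; split=> //; split=> //.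
- by move=> j i jm i_n; rewrite tE // H.
- by move=> j i jm i_n; rewrite tE // H.
Qed.

Section NormValues.
Variables (R : realType) (b : bool) (G : bigraph).

Lemma schur_norm_le_F k : (0 < k <= 6)%N -> ind_le G (F_ k) ->
  (schur_norm R b G <= (eta_k R k)%:E)%E.
Proof.
move=> k6; rewrite F_rowsE; have : let: (D, P, Q, lam, al, be) := up_cert k in
    up_check (eta_disc k) (F_rows k) (eta_num k) (eta_den k) D P Q lam al be.
  by case: k k6 => [|[|[|[|[|[|[|k]]]]]]] //= _; vm_compute.
case: (up_cert k) => [[[[[D P] Q] lam] al] be].
by apply: (up_checkP b (eta_sqr R k6)); exact: eta_ge0.
Qed.

Lemma schur_norm_ge_E k : (0 < k <= 6)%N -> ind_le (E_ k) G ->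
  ((eta_k R k)%:E <= schur_norm R b G)%E.
Proof.
move=> k6; rewrite E_rowsE => EG.
pose rows := if k == 5%N then tr_rows (E_rows k) else E_rows k.
apply: (low_checkP (rows := rows) b (eta_sqr R k6)
  (p := (low_cert k).1) (y := (low_cert k).2)).
  by case: k k6 {EG} @rows => [|[|[|[|[|[|[|k]]]]]]] //= _; vm_compute.
by rewrite /rows; case: eqP EG => // -> EG; apply: ind_le_tr EG.
Qed.

End NormValues.

(** * Growing induced subgraphs *)

Section Growth.
Local Open Scope nat_scope.
Implicit Types (S T : seq (seq nat)) (G : bigraph) (f g : nat -> nat).

Definition emb S G f g : Prop :=
  [/\ emb_ok (Some (size S)) (nR G) f, emb_ok (Some (ncols S)) (nC G) g &
      forall i j, i < size S -> j < ncols S -> ent S i j = edge G (f i) (g j)].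

(** Side-preserving form of [ind_le (mxg S) G]. Swaps are accounted for by transposed matrices
    instead, so that rows and columns of a state keep their meaning while it grows. *)
Definition semb S G : Prop := exists f g, emb S G f g.

Lemma semb_trans T S G : semb T (mxg S) -> semb S G -> semb T G.
Proof.
move=> [f [g [[fV fI] [gV gI] TS]]] [f' [g' [[fV' fI'] [gV' gI'] SG]]].
exists (f' \o f), (g' \o g); split.
- split=> [i /fV /fV' //|i i' iT iT' /= /fI' H].
  by apply: fI => //; apply: H; exact: fV.
- split=> [j /gV /gV' //|j j' jT jT' /= /gI' H].
  by apply: gI => //; apply: H; exact: gV.
- move=> i j iT jT /=; rewrite TS // -SG.
  - by rewrite edge_mxg; [|exact: fV|exact: gV].
  - exact: fV.
  - exact: gV.
Qed.

Lemma semb_ind_le T G : semb T G -> ind_le (mxg T) G.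
Proof.
move=> [f [g [fV gV TG]]]; exists f, g; left; split=> //; split=> // i j iT jT.
by rewrite edge_mxg // TG.
Qed.

Lemma semb_tr_ind_le T G : 0 < ncols T -> semb (tr_rows T) G -> ind_le (mxg T) G.
Proof.
move=> T0 [f [g []]]; rewrite size_tr ncols_tr // => fV gV TG.
exists g, f; right; split=> //; split=> // i j iT jT.
by rewrite edge_mxg // -TG // ent_tr.
Qed.

Definition is_emb T S (fs gs : seq nat) : bool :=
  [&& uniq fs, uniq gs, size fs == size T, size gs == ncols T,
      all (fun i => i < size S) fs, all (fun j => j < ncols S) gs &
      all_below (size T) (fun i => all_below (ncols T) (fun j =>
        ent T i j == ent S (nth 0 fs i) (nth 0 gs j)))].

(* Unlike [has], stops at the first hit under call-by-value evaluation. *)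
Fixpoint has_lazy (A : Type) (p : pred A) (s : seq A) : bool :=
  if s is x :: s' then (if p x then true else has_lazy p s') else false.

Lemma has_lazyE (A : Type) (p : pred A) s : has_lazy p s = has p s.
Proof. by elim: s => //= x s ->; case: (p x). Qed.

(** Once the rows are placed, equal columns are interchangeable, so taking the first available match
    loses no embedding. *)
Fixpoint col_match (tc : seq (seq nat)) (sc : seq (nat * seq nat)) :
    option (seq nat) :=
  if tc is c :: tc' then
    let k := find (fun p => p.2 == c) sc in
    if k < size sc then
      omap (cons (nth (0, [::]) sc k).1) (col_match tc' (take k sc ++ drop k.+1 sc))
    else None
  else Some [::].

(* Depth-first over the rows, greedy on the columns; the answer is verified by
   [is_emb], so only soundness matters. *)
Definition col_search S (rs : seq (seq nat)) (fs : seq nat) : option (seq nat) :=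
  col_match (tr_rows rs)
    (zip (iota 0 (ncols S)) (tr_rows [seq nth [::] S i | i <- fs])).

Fixpoint row_search T S (rs pre : seq (seq nat)) (fs : seq nat) : bool :=
  if rs is r :: rs' then
    has_lazy (fun x =>
      if x \in fs then false
      else if col_search S (rcons pre r) (rcons fs x) is Some _
      then row_search T S rs' (rcons pre r) (rcons fs x) else false)
    (iota 0 (size S))
  else if col_search S T fs is Some gs then is_emb T S fs gs else false.

Definition fits T S : bool :=
  if (size T <= size S) && (ncols T <= ncols S)
  then row_search T S T [::] [::] else false.

Lemma row_searchP T S rs pre fs : row_search T S rs pre fs ->
  exists fs' gs', is_emb T S fs' gs'.
Proof.
elim: rs pre fs => [|r rs IH] pre fs /=.
  by case: col_search => // gs E; exists fs, gs.
rewrite has_lazyE => /hasP[x _]; case: ifP => // _; case: col_search => // _.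
exact: IH.
Qed.

Lemma fitsP T S : fits T S -> semb T (mxg S).
Proof.
rewrite /fits; case: ifP => // _ /row_searchP[fs [gs]].
case/and5P=> fsU gsU /eqP fsT /eqP gsT /and3P[/allP fsS /allP gsS TS].
exists (nth 0 fs), (nth 0 gs); split.
- split=> [i iT|i i' iT iT' /eqP]; first by apply: fsS; rewrite mem_nth // fsT.
  by rewrite nth_uniq ?fsT // => /eqP.
- split=> [i iT|i i' iT iT' /eqP]; first by apply: gsS; rewrite mem_nth // gsT.
  by rewrite nth_uniq ?gsT // => /eqP.
- move=> i j iT jT; rewrite edge_mxg ?(eqP (all_belowP (all_belowP TS iT) jT)) //.
    by apply: fsS; rewrite mem_nth // fsT.
  by apply: gsS; rewrite mem_nth // gsT.
Qed.

Definition wf S : bool :=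
  [&& 0 < size S, 0 < ncols S & all (fun r => size r == ncols S) S].

Fixpoint vecs (n : nat) : seq (seq nat) :=
  if n is n'.+1 then
    [seq 0 :: v | v <- vecs n'] ++ [seq 1 :: v | v <- vecs n']
  else [:: [::]].

Lemma mem_vecs n (h : nat -> bool) : mkseq (fun i => nat_of_bool (h i)) n \in vecs n.
Proof.
rewrite /mkseq; elim: n 0 => [|n IH] k //=; rewrite mem_cat.
by case: (h k); rewrite map_f ?orbT.
Qed.

Definition add_col S (v : seq nat) : seq (seq nat) :=
  mkseq (fun i => rcons (nth [::] S i) (nth 0 v i)) (size S).
Definition add_row S (v : seq nat) : seq (seq nat) := rcons S v.

Lemma wf_row S i : wf S -> i < size S -> size (nth [::] S i) = ncols S.
Proof. by case/and3P=> _ _ /allP H iS; apply/eqP/H/mem_nth. Qed.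

Lemma ncols_add_col S v : wf S -> ncols (add_col S v) = (ncols S).+1.
Proof.
move=> wS; rewrite /ncols /add_col; case: S wS => [|r S] // wS.
by rewrite /= size_rcons.
Qed.

Lemma emb_ok_ext n s f c : emb_ok (Some n) s f -> inV s c ->
  (forall i, i < n -> f i != c) ->
  emb_ok (Some n.+1) s (fun i => if i == n then c else f i).
Proof.
move=> [fV fI] cV fc; split=> [i|i i']; rewrite /= !ltnS.
  by move=> i_n; case: eqP => // /eqP ne; apply: fV; rewrite /= ltn_neqAle ne.
move=> i_n i_n'; case: eqP => [->|/eqP ne]; case: eqP => [->|/eqP ne'] //.
- by move=> e; have := fc i'; rewrite ltn_neqAle ne' i_n' e eqxx => /(_ isT).
- by move=> e; have := fc i; rewrite ltn_neqAle ne i_n e eqxx => /(_ isT).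
- by apply: fI; rewrite /= ltn_neqAle ?ne ?ne'.
Qed.

Lemma emb_add_col S G f g c : wf S -> emb S G f g -> inV (nC G) c ->
  (forall j, j < ncols S -> g j != c) ->
  semb (add_col S (mkseq (fun i => nat_of_bool (edge G (f i) c)) (size S))) G.
Proof.
move=> wS [fV gV SG] cV gc; set v := mkseq _ _.
exists f, (fun j => if j == ncols S then c else g j).
have sS : size (add_col S v) = size S by rewrite size_mkseq.
split; rewrite ?sS ?ncols_add_col //; first exact: emb_ok_ext.
move=> i j iS jS; rewrite {1}/ent nth_mkseq // nth_rcons wf_row //.
rewrite ltnS leq_eqVlt in jS; case: eqP jS => [->|/eqP ne /= jS].
  by rewrite ltnn nth_mkseq //; case: edge.
by rewrite jS -SG.
Qed.

Lemma emb_add_row S G f g c : wf S -> emb S G f g -> inV (nR G) c ->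
  (forall i, i < size S -> f i != c) ->
  semb (add_row S (mkseq (fun j => nat_of_bool (edge G c (g j))) (ncols S))) G.
Proof.
move=> wS [fV gV SG] cV fc; set v := mkseq _ _.
exists (fun i => if i == size S then c else f i), g.
have sS : size (add_row S v) = (size S).+1 by rewrite size_rcons.
have cS : ncols (add_row S v) = ncols S.
  by case/and3P: wS => + _ _; rewrite /ncols /add_row; case: (S).
split; rewrite ?sS ?cS //; first exact: emb_ok_ext.
move=> i j iS jS; rewrite {1}/ent nth_rcons.
rewrite ltnS leq_eqVlt in iS; case: eqP iS => [->|/eqP ne /= iS].
  by rewrite ltnn nth_mkseq //; case: edge.
by rewrite iS -SG.
Qed.

Definition row_twins S : option (nat * nat) :=
  ohead [seq p <- [seq (i, i') | i <- iota 0 (size S), i' <- iota 0 (size S)] |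
    (p.1 < p.2) && (nth [::] S p.1 == nth [::] S p.2)].

Lemma row_twinsP S i i' : row_twins S = Some (i, i') ->
  [/\ i < size S, i' < size S, i != i' & nth [::] S i = nth [::] S i'].
Proof.
rewrite /row_twins; set l := (X in ohead X); case E : l => [|p s] //= [pE].
have : p \in p :: s by rewrite mem_head.
rewrite -E /l mem_filter pE /= => /andP[/andP[lt /eqP e] /allpairsP[[a c] /= []]].
rewrite !mem_iota !add0n /= => ai ci [ia ic]; rewrite ia ic in lt e *.
by split=> //; move: lt; rewrite ltn_neqAle => /andP[].
Qed.

Definition vcount S : nat := size S + ncols S.

Section Closure.
Variables (Fb L : seq (seq (seq nat))) (fin : seq (seq nat) -> bool).

(** States are recognised by embedding, so [L] needs only one ordering of each. The strict increase
    of [vcount] makes the growth terminate. *)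
Definition good (k : nat) S : bool :=
  if has_lazy (fits^~ S) Fb then true
  else has_lazy (fun T => if k < vcount T then fits T S else false) L.

(** Twins of [S] are not twins in [G], so some vertex of [G] separates them and only vectors that
    differ at the pair matter. If [S] has no twins, either it exhausts [G], or by connectedness some
    vertex outside has a neighbour inside, so only nonzero vectors matter. *)
Definition step_ok S : bool :=
  if row_twins S is Some (i, i') then
    all (fun v => if nth 0 v i == nth 0 v i' then true
                  else good (vcount S) (add_col S v))
      (vecs (size S))
  else if row_twins (tr_rows S) is Some (j, j') then
    all (fun v => if nth 0 v j == nth 0 v j' then true
                  else good (vcount S) (add_row S v))
      (vecs (ncols S))
  else
    [&& fin S,
      all (fun v => if all (pred1 0) v then true
                    else good (vcount S) (add_col S v))
        (vecs (size S)) &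
      all (fun v => if all (pred1 0) v then true
                    else good (vcount S) (add_row S v))
        (vecs (ncols S))].

(** The bound 12 serves the induction on [12 - vcount S] in [growth]; the states listed later have
    at most 10 vertices. *)
Definition closed_states : bool :=
  all (fun S => [&& wf S, vcount S <= 12 & step_ok S]) L.

Variable G : bigraph.
Hypotheses (closedL : closed_states) (tfG : twin_free G) (cnG : bg_connected G).
Hypothesis avoids : forall T, T \in Fb -> ~ semb T G.

Lemma goodP k S : good k S -> semb S G ->
  exists T, [/\ T \in L, k < vcount T & semb T G].
Proof.
rewrite /good !has_lazyE => + SG; case: ifP => [/hasP[T TF] /fitsP TS _|_].
  by case: (avoids TF); exact: semb_trans TS SG.
case/hasP=> T TL; case: ifP => // kT /fitsP TS; exists T; split=> //.
exact: semb_trans TS SG.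
Qed.

Lemma leaves_set (P : nat + nat -> Prop) u w :
  clos_refl_trans (nat + nat) (vadj G) u w -> P u -> ~ P w ->
  exists x y, [/\ P x, ~ P y & vadj G x y].
Proof.
move=> uw; elim: (clos_rt_rt1n _ _ _ _ uw) => [x Px //|x y z xy _ IH Px nPz].
have [Py|nPy] := pselect (P y); first exact: IH.
by exists x, y.
Qed.

Lemma step_semb S : S \in L -> semb S G ->
  (exists T, [/\ T \in L, vcount S < vcount T & semb T G]) \/
  fin S /\ exists f g, [/\ emb S G f g,
    forall i, inV (nR G) i -> exists2 k, k < size S & f k = i &
    forall j, inV (nC G) j -> exists2 k, k < ncols S & g k = j].
Proof.
move=> SL [f [g SG]]; have := allP closedL S SL; case/and3P=> wS _.
have [[fV fI] [gV gI] SE] := SG; have /and3P[n0 m0 _] := wS.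
rewrite /step_ok; case E : row_twins => [[i i']|].
  have [iS iS' ne eqr] := row_twinsP E => /allP Hv; left.
  have [c cV cne] : exists2 c, inV (nC G) c & edge G (f i) c != edge G (f i') c.
    apply: contrapT => H; move/eqP: ne; case; apply: fI => //.
    apply: tfG.1; [exact: fV|exact: fV|move=> c cV].
    by apply/eqP; apply: contrapT => /negP ne; apply: H; exists c.
  (* A vertex already in the image cannot separate the pair, whose rows in [S] are equal. *)
  have gc j : j < ncols S -> g j != c.
    move=> jS; apply: contraNneq cne => <-; rewrite -!SE //.
    by rewrite /ent eqr.
  have := Hv _ (mem_vecs (size S) (fun i => edge G (f i) c)).
  rewrite !nth_mkseq //; case: ifP => [/eqP e _|_ /goodP]; last first.
    by apply; exact: (emb_add_col wS SG).
  by move: e cne; do 2 case: edge.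
case E' : row_twins => [[j j']|].
  have [jS jS' ne] := row_twinsP E'; rewrite size_tr in jS jS'.
  rewrite !nth_mkseq // => eqc /allP Hv; left.
  have [c cV cne] : exists2 c, inV (nR G) c & edge G c (g j) != edge G c (g j').
    apply: contrapT => H; move/eqP: ne; case; apply: gI => //.
    apply: tfG.2; [exact: gV|exact: gV|move=> c cV].
    by apply/eqP; apply: contrapT => /negP ne; apply: H; exists c.
  have fc i : i < size S -> f i != c.
    move=> iS; apply: contraNneq cne => <-; rewrite -!SE //.
    have := congr1 (nth 0 ^~ i) eqc; rewrite !nth_mkseq // => e.
    by rewrite /ent e.
  have := Hv _ (mem_vecs (ncols S) (fun j => edge G c (g j))).
  rewrite !nth_mkseq //; case: ifP => [/eqP e _|_ /goodP]; last first.
    by apply; exact: (emb_add_row wS SG).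
  by move: e cne; do 2 case: edge.
case/and3P=> finS /allP Hc /allP Hr.
pose inS (u : nat + nat) : Prop := match u with
  | inl i => exists2 k, k < size S & f k = i
  | inr j => exists2 k, k < ncols S & g k = j end.
have [all_in|] := pselect (forall u, vok G u -> inS u).
  right; split=> //; exists f, g; split=> // [i iR|j jC].
    exact: (all_in (inl i)).
  exact: (all_in (inr j)).
move=> /existsNP[u /not_implyP[uG nu]]; left.
have u0 : inS (inl (f 0)) by exists 0.
(* A path from an embedded vertex to a missed one has an edge leaving the image; the outer end of
   that edge gives a nonzero vector. *)
have [x [y [Px nPy xy]]] := leaves_set (cnG (fV 0 n0 : vok G (inl (f 0))) uG) u0 nu.
case: x y Px nPy xy => [a|a] [c|c] //= [k kS <-] nPy kc.
  have cV : inV (nC G) c by case/and3P: kc.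
  have := Hc _ (mem_vecs (size S) (fun i => edge G (f i) c)).
  case: ifP => [/allP e _|_ /goodP]; last first.
    apply; apply: (emb_add_col wS SG) => // j jS; apply: contra_notN nPy => /eqP <-.
    by exists j.
  have := e (nth 0 (mkseq (fun i => nat_of_bool (edge G (f i) c)) (size S)) k).
  by rewrite mem_nth ?size_mkseq // nth_mkseq // kc => /(_ isT).
have cV : inV (nR G) c by case/and3P: kc.
have := Hr _ (mem_vecs (ncols S) (fun j => edge G c (g j))).
case: ifP => [/allP e _|_ /goodP]; last first.
  apply; apply: (emb_add_row wS SG) => // j jS; apply: contra_notN nPy => /eqP <-.
  by exists j.
have := e (nth 0 (mkseq (fun j => nat_of_bool (edge G c (g j))) (ncols S)) k).
by rewrite mem_nth ?size_mkseq // nth_mkseq // kc => /(_ isT).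
Qed.

(** With [fin] constantly false the conclusion is absurd, so that no state of [L] embeds in [G]. *)
Lemma growth S : S \in L -> semb S G ->
  exists2 T, fin T & exists f g, [/\ emb T G f g,
    forall i, inV (nR G) i -> exists2 k, k < size T & f k = i &
    forall j, inV (nC G) j -> exists2 k, k < ncols T & g k = j].
Proof.
have [t] := ubnP (12 - vcount S); elim: t S => // t IH S St SL SG.
have [[T [TL ST TG]]|[finS H]] := step_semb SL SG; last by exists S.
apply: (IH T _ TL TG); have /and3P[_ T12 _] := allP closedL T TL.
by rewrite (leq_trans _ (St : 12 - vcount S <= t)) // ltn_sub2l // (leq_trans ST).
Qed.

End Closure.

End Growth.

(** * Classification *)

Section ForbiddenData.
Local Open Scope Z_scope.

(* Each matrix comes with the data (p, y) of a test matrix for it. *)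
Definition forb_cert : seq (seq (seq nat) * (seq Z * seq (seq Z))) := [::
    ([:: [:: 0; 0; 1]; [:: 0; 1; 1]; [:: 1; 1; 1]]%nat,
     ([:: 1; 1; 2],
      [:: [:: 0; -2; 3]; [:: -2; 2; 2]; [:: 2; 1; 1]]));
    ([:: [:: 0; 1; 1]; [:: 1; 0; 1]; [:: 1; 1; 1]]%nat,
     ([:: 1; 1; 2],
      [:: [:: -1; 1; 2]; [:: 1; -1; 2]; [:: 1; 1; 0]]));
    ([:: [:: 0; 0; 0; 1]; [:: 0; 0; 1; 1]; [:: 0; 1; 0; 1];
    [:: 1; 0; 0; 1]]%nat,
     ([:: 1; 1; 1; 1],
      [:: [:: -4; -4; -4; 12]; [:: -1; -1; 8; 8]; [:: -1; 8; -1; 8];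
      [:: 8; -1; -1; 8]]));
    ([:: [:: 0; 1; 1]; [:: 1; 0; 1]; [:: 1; 1; 0]]%nat,
     ([:: 1; 1; 1],
      [:: [:: -1; 2; 2]; [:: 2; -1; 2]; [:: 2; 2; -1]]));
    ([:: [:: 0; 0; 0; 1]; [:: 0; 0; 1; 0]; [:: 0; 1; 0; 1];
    [:: 1; 0; 1; 1]]%nat,
     ([:: 1; 1; 1; 2],
      [:: [:: -7; -6; -3; 19]; [:: -7; 1; 17; -3]; [:: -2; 11; -2; 13];
      [:: 7; -1; 7; 10]]));
    ([:: [:: 0; 0; 0; 1]; [:: 0; 0; 1; 1]; [:: 0; 1; 1; 0];
    [:: 1; 0; 1; 0]]%nat,
     ([:: 1; 2; 2; 2],
      [:: [:: 9; 9; -12; 23]; [:: -6; -6; 21; 12]; [:: -3; 13; 18; -3];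
      [:: 13; -3; 18; -3]]));
    ([:: [:: 0; 0; 0; 1]; [:: 0; 0; 1; 1]; [:: 0; 1; 0; 1];
    [:: 1; 0; 1; 0]]%nat,
     ([:: 1; 4; 2; 2],
      [:: [:: 14; -17; -22; 41]; [:: -5; -3; 20; 20]; [:: 2; 20; -7; 24];
      [:: 16; 3; 23; -8]]));
    ([:: [:: 0; 0; 0; 0; 1]; [:: 0; 0; 0; 1; 1]; [:: 0; 0; 1; 1; 0];
    [:: 0; 1; 1; 0; 0]; [:: 1; 1; 0; 0; 0]]%nat,
     ([:: 1; 4; 6; 5; 2],
      [:: [:: 13; -17; 19; -23; 38]; [:: -4; 7; -11; 26; 14];
      [:: 3; -7; 22; 19; -4]; [:: -4; 20; 22; -7; 3];
      [:: 16; 27; -11; 7; -4]]));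
    ([:: [:: 0; 0; 0; 1; 1]; [:: 0; 0; 1; 0; 1]; [:: 0; 1; 0; 1; 0];
    [:: 1; 0; 1; 0; 0]; [:: 1; 1; 0; 0; 0]]%nat,
     ([:: 1; 1; 1; 1; 1],
      [:: [:: 3; -4; -4; 10; 10]; [:: -4; 3; 10; -4; 10];
      [:: -4; 10; 3; 10; -4]; [:: 10; -4; 10; 3; -4];
      [:: 10; 10; -4; -4; 3]]))].

End ForbiddenData.

Definition c4_states : seq (seq (seq nat)) := [::
    [:: [:: 1; 1]; [:: 1; 1]]; [:: [:: 0; 1; 1]; [:: 1; 1; 1]]]%N.

Definition k14_states : seq (seq (seq nat)) := [::
    [:: [:: 1; 1; 1; 1]]; [:: [:: 0; 0; 0; 1]; [:: 1; 1; 1; 1]];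
    [:: [:: 0; 0; 0; 1]; [:: 0; 0; 1; 0]; [:: 1; 1; 1; 1]]]%N.

Definition edge_states : seq (seq (seq nat)) := [::
    [:: [:: 1]];
    [:: [:: 1; 1]];
    [:: [:: 0; 1]; [:: 1; 1]];
    [:: [:: 0; 0; 1]; [:: 1; 1; 1]];
    [:: [:: 0; 1; 1]; [:: 1; 0; 1]];
    [:: [:: 0; 0; 1]; [:: 0; 1; 1]; [:: 1; 0; 1]];
    [:: [:: 0; 0; 1; 1]; [:: 1; 1; 0; 1]];
    [:: [:: 0; 0; 1]; [:: 0; 1; 1]; [:: 1; 1; 0]];
    [:: [:: 0; 0; 0; 1]; [:: 0; 0; 1; 1]; [:: 1; 1; 0; 1]];
    [:: [:: 0; 0; 1; 1]; [:: 0; 1; 0; 1]; [:: 1; 0; 0; 1]];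
    [:: [:: 0; 0; 0; 1]; [:: 0; 1; 1; 0]; [:: 1; 0; 1; 1]];
    [:: [:: 0; 0; 0; 1]; [:: 0; 0; 1; 1]; [:: 1; 1; 1; 0]];
    [:: [:: 0; 0; 1; 1]; [:: 0; 1; 0; 1]; [:: 1; 0; 1; 0]];
    [:: [:: 0; 0; 0; 1; 1]; [:: 0; 0; 1; 0; 1]; [:: 1; 1; 0; 0; 1]];
    [:: [:: 0; 0; 0; 0; 1]; [:: 0; 0; 1; 1; 1]; [:: 1; 1; 0; 1; 0]];
    [:: [:: 0; 0; 0; 1; 1]; [:: 0; 1; 1; 0; 0]; [:: 1; 0; 1; 0; 1]];
    [:: [:: 0; 0; 0; 1]; [:: 0; 0; 1; 0]; [:: 0; 0; 1; 1]; [:: 1; 1; 0; 1]];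
    [:: [:: 0; 0; 0; 1; 1]; [:: 0; 0; 1; 0; 1]; [:: 1; 1; 0; 1; 0]];
    [:: [:: 0; 0; 0; 1]; [:: 0; 0; 1; 1]; [:: 0; 1; 1; 0]; [:: 1; 1; 0; 0]];
    [:: [:: 0; 0; 1; 1]; [:: 0; 1; 0; 1]; [:: 1; 0; 1; 0]; [:: 1; 1; 0; 0]];
    [:: [:: 0; 0; 0; 0; 1; 1]; [:: 0; 0; 1; 1; 0; 1]; [:: 1; 1; 0; 1; 0; 0]];
    [:: [:: 0; 0; 0; 0; 1]; [:: 0; 0; 0; 1; 1]; [:: 0; 0; 1; 1; 0];
        [:: 1; 1; 1; 0; 0]];
    [:: [:: 0; 0; 0; 1; 1]; [:: 0; 0; 1; 0; 1]; [:: 0; 1; 0; 1; 0];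
        [:: 1; 0; 1; 0; 0]];
    [:: [:: 0; 0; 0; 0; 1; 1]; [:: 0; 0; 0; 1; 0; 1]; [:: 0; 0; 1; 0; 1; 0];
        [:: 1; 1; 0; 1; 0; 0]]]%N.

(** In order: the 4-cycle with a pendant vertex at each end of one edge; two 4-cycles sharing an
    edge; the spider with legs 2, 2, 2, 1; the 6-cycle; the path on six vertices with a pendant
    vertex at each of the two middle ones; the spiders with legs 3, 2, 2 and 4, 2, 1; the path on
    ten vertices; the 10-cycle. *)
Definition forb : seq (seq (seq nat)) := unzip1 forb_cert.

Definition with_tr (l : seq (seq (seq nat))) : seq (seq (seq nat)) :=
  l ++ map tr_rows l.

(* 97 / 64 separates eta_6 ^ 2 from the certified squared norms. *)
Lemma eta6_lt_schur_norm (R : realType) (b : bool) (G : bigraph) T :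
  T \in forb -> ind_le (mxg T) G -> ((eta_k R 6)%:E < schur_norm R b G)%E.
Proof.
move=> /mapP[[T' [p y]] Tc -> /=] TG; pose c : R := Num.sqrt (97%:R / 64%:R).
have c2 : c ^+ 2 = 97%:R / 64%:R by rewrite sqr_sqrtr // divr_ge0.
have cE : c ^+ 2 * zr R (Z.of_nat 64) =
    qev (Z.of_nat 5) R (quad_int (Z.of_nat 97)).
  by rewrite qev_int !zr_nat c2; field.
apply: (@lt_le_trans _ _ c%:E); last first.
  apply: (low_checkP b cE (p := map quad_int p) (y := map (map quad_int) y)) TG.
  suff /allP/(_ _ Tc) : all (fun x => low_check (Z.of_nat 5) x.1
     (quad_int (Z.of_nat 97)) (Z.of_nat 64)
     (map quad_int x.2.1) (map (map quad_int) x.2.2)) forb_cert by [].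
  by vm_compute.
rewrite lte_fin -(@ltr_pXn2r _ 2) // ?nnegrE ?sqrtr_ge0 ?eta_ge0 // c2.
have s5 := sqrt_prop R 5; have p5 := sqrtr_ge0 (5%:R : R).
(* The square of [eta_k R 6] is (20 + 8 sqrt 5) / 25, about 1.51554, while 97/64 = 1.515625. The
   margin below 10^-4 dictates the precision for sqrt 5. *)
have e5 : Num.sqrt (5%:R : R) < 22361 / 10000 by nra.
by rewrite /= exprMn [Num.sqrt (_ + _) ^+ 2]sqr_sqrtr; lra.
Qed.

Definition fin_state (S : seq (seq nat)) : bool :=
  has (fun k => (fits (E_rows k) S || fits (tr_rows (E_rows k)) S) &&
                (fits S (F_rows k) || fits (tr_rows S) (F_rows k))) (iota 1 6).

Definition c4 : seq (seq nat) := [:: [:: 1; 1]; [:: 1; 1]]%N.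
Definition k14 : seq (seq nat) := [:: [:: 1; 1; 1; 1]]%N.

(** Separating the twin rows of the 4-cycle leads to the second state; separating the twin columns
    of that state leads to the first or second matrix of [forb]. *)
Lemma c4_closed :
  closed_states (with_tr forb) (with_tr c4_states) (fun=> false).
Proof. by vm_compute. Qed.

(** In the absence of 4-cycles, a row that separates two leaves meets exactly one leaf. Three such
    rows yield the transpose of the third matrix of [forb]. *)
Lemma k14_closed :
  closed_states (with_tr (c4 :: forb)) (with_tr k14_states) (fun=> false).
Proof. by vm_compute. Qed.

Lemma edge_closed :
  closed_states (with_tr (c4 :: k14 :: forb)) (with_tr edge_states) fin_state.
Proof. by vm_compute. Qed.

Section Classification.
Variable G : bigraph.
Hypotheses (okG : in_Gamma G) (tfG : twin_free G) (cnG : bg_connected G).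
Hypothesis avoids : forall T, T \in forb -> ~ ind_le (mxg T) G.

Lemma avoid_with_tr l : (forall T, T \in l -> ~ semb T G /\ ~ semb (tr_rows T) G) ->
  forall T, T \in with_tr l -> ~ semb T G.
Proof.
move=> H T; rewrite mem_cat => /orP[/H[]//|/mapP[T' /H[_ nT] ->]].
exact: nT.
Qed.

Lemma avoid_forb T : T \in forb -> ~ semb T G /\ ~ semb (tr_rows T) G.
Proof.
move=> TF; have T0 : (0 < ncols T)%N.
  by apply: (allP (_ : all (fun T => 0 < ncols T)%N forb)) TF; vm_compute.
split=> TG; first exact: avoids TF (semb_ind_le TG).
exact: avoids TF (semb_tr_ind_le T0 TG).
Qed.

Lemma avoid_c4 : ~ semb c4 G.
Proof.
move=> cG; have c4L : c4 \in with_tr c4_states by vm_compute.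
by have [] := growth c4_closed tfG cnG (avoid_with_tr avoid_forb) c4L cG.
Qed.

Lemma avoid_c4_forb T : T \in c4 :: forb -> ~ semb T G /\ ~ semb (tr_rows T) G.
Proof.
rewrite inE => /orP[/eqP ->|]; last exact: avoid_forb.
by split; exact: avoid_c4.
Qed.

Lemma avoid_k14 T : T \in with_tr k14_states -> ~ semb T G.
Proof.
move=> TL TG.
by have [] := growth k14_closed tfG cnG (avoid_with_tr avoid_c4_forb) TL TG.
Qed.

(** Both sides are nonempty, so a path joins row 0 to column 0, and it must change sides
    somewhere. *)
Lemma has_edge : semb [:: [:: 1%N]] G.
Proof.
have /andP[R0 C0] := okG.
have R0' : vok G (inl 0%N) by move: R0; rewrite /= /inV; case: (nR G).
have C0' : vok G (inr 0%N) by move: C0; rewrite /= /inV; case: (nC G).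
have [x [y []]] := leaves_set (P := fun u => if u is inl _ then True else False)
  (cnG R0' C0') I id.
case: x => // i _; case: y => [j /(_ I) //|j _ /= ij].
have /and3P[iR jC _] := ij.
exists (fun=> i), (fun=> j); split.
- by split=> // -[|k] [|k'].
- by split=> // -[|k] [|k'].
- by move=> [|k] [|k'] //= _ _; rewrite ij.
Qed.

Lemma classification :
  exists2 k, (1 <= k <= 6)%N & ind_le (E_ k) G /\ ind_le G (F_ k).
Proof.
have avoid3 T : T \in c4 :: k14 :: forb -> ~ semb T G /\ ~ semb (tr_rows T) G.
  rewrite inE => /orP[/eqP ->|]; first by split; exact: avoid_c4.
  rewrite inE => /orP[/eqP ->|]; last exact: avoid_forb.
  by split; apply: avoid_k14; vm_compute.
have edgeL : [:: [:: 1%N]] \in with_tr edge_states by vm_compute.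
have [S /hasP[k k6 /andP[ES SF]] [f [g [SG fS gS]]]] :=
  growth edge_closed tfG cnG (avoid_with_tr avoid3) edgeL has_edge.
exists k; first by move: k6; rewrite mem_iota.
have SG' : semb S G by exists f, g.
split.
  rewrite E_rowsE; case/orP: ES => /fitsP /semb_trans /(_ SG').
    exact: semb_ind_le.
  by apply: semb_tr_ind_le; case: k {k6 SF} => [|[|[|[|[|[|[|k]]]]]]].
(* The embedding of [S] is onto, hence invertible: the index in the list of its values gives the
   inverses [f'] and [g'], and composing with them turns an embedding of [S] in [F_rows k] into one
   of [G]. *)
pose f' i := index i (mkseq f (size S)); pose g' j := index j (mkseq g (ncols S)).
have f'P i : inV (nR G) i -> (f' i < size S)%N /\ f (f' i) = i.
  move=> /fS[a aS <-]; have fm : f a \in mkseq f (size S).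
    by rewrite map_f // mem_iota.
  have lt : (f' (f a) < size S)%N by rewrite -[X in (_ < X)%N](size_mkseq f)
    index_mem.
  by split=> //; rewrite -[RHS](nth_index 0%N fm) nth_mkseq.
have g'P j : inV (nC G) j -> (g' j < ncols S)%N /\ g (g' j) = j.
  move=> /gS[a aS <-]; have gm : g a \in mkseq g (ncols S).
    by rewrite map_f // mem_iota.
  have lt : (g' (g a) < ncols S)%N by rewrite -[X in (_ < X)%N](size_mkseq g)
    index_mem.
  by split=> //; rewrite -[RHS](nth_index 0%N gm) nth_mkseq.
have f'I i i' : inV (nR G) i -> inV (nR G) i' -> f' i = f' i' -> i = i'.
  by move=> /f'P[_ {2}<-] /f'P[_ {2}<-] ->.
have g'I j j' : inV (nC G) j -> inV (nC G) j' -> g' j = g' j' -> j = j'.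
  by move=> /g'P[_ {2}<-] /g'P[_ {2}<-] ->.
have SE i j : inV (nR G) i -> inV (nC G) j -> edge G i j = ent S (f' i) (g' j).
  move=> /f'P[iS fi] /g'P[jS gj]; have [_ _ ->//] := SG.
  by rewrite fi gj.
rewrite F_rowsE; case/orP: SF => /fitsP [u [w []]].
  move=> [uV uI] [wV wI] SF; exists (u \o f'), (w \o g'); left; split; last split.
  - split=> [i /f'P[iS _]|i i' iV iV' /= /uI H]; first exact: uV.
    by apply: f'I => //; apply: H; [have [] := f'P _ iV|have [] := f'P _ iV'].
  - split=> [j /g'P[jS _]|j j' jV jV' /= /wI H]; first exact: wV.
    by apply: g'I => //; apply: H; [have [] := g'P _ jV|have [] := g'P _ jV'].
  - move=> i j iV jV; rewrite SE //= SF //; first by have [] := f'P _ iV.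
    by have [] := g'P _ jV.
have S0 : (0 < ncols S)%N.
  have /andP[_ C0] := okG; have /gS[a aS _] : inV (nC G) 0.
    by move: C0; rewrite /inV; case: (nC G).
  exact: leq_ltn_trans aS.
rewrite size_tr ncols_tr // => -[uV uI] [wV wI] SF.
exists (w \o f'), (u \o g'); right; split; last split.
- split=> [i /f'P[iS _]|i i' iV iV' /= /wI H]; first exact: wV.
  by apply: f'I => //; apply: H; [have [] := f'P _ iV|have [] := f'P _ iV'].
- split=> [j /g'P[jS _]|j j' jV jV' /= /uI H]; first exact: uV.
  by apply: g'I => //; apply: H; [have [] := g'P _ jV|have [] := g'P _ jV'].
- move=> i j iV jV; have [iS _] := f'P _ iV; have [jS _] := g'P _ jV.
  by rewrite SE //= -SF // ent_tr.
Qed.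

End Classification.

(* b = false : F = R ;  b = true : F = C *)
Theorem theorem6p7 (R : realType) (b : bool) (G : bigraph) :
  in_Gamma G -> twin_free G -> bg_connected G ->
  forall k : nat, (1 <= k <= 6)%N ->
    ((ind_le (E_ k) G /\ ind_le G (F_ k)) <->
       schur_norm R b G = (eta_k R k)%:E) /\
    (schur_norm R b G = (eta_k R k)%:E <->
       ((eta_k R k.-1)%:E < schur_norm R b G /\
        schur_norm R b G <= (eta_k R k)%:E)%E).
Proof.
move=> okG tfG cnG k k6.
have exact_norm j : (1 <= j <= 6)%N -> ind_le (E_ j) G -> ind_le G (F_ j) ->
    schur_norm R b G = (eta_k R j)%:E.
  move=> j6 EG GF; apply/eqP; rewrite eq_le schur_norm_le_F //=.
  exact: schur_norm_ge_E.
(* An upper bound of at most [eta_k R 6] excludes the nine graphs, so the classification yields some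
   [j] for which the norm is exactly [eta_k R j]. By strict monotonicity the half-open interval
   contains only the value with [j = k]. *)
have to_class : ((eta_k R k.-1)%:E < schur_norm R b G)%E ->
    (schur_norm R b G <= (eta_k R k)%:E)%E -> ind_le (E_ k) G /\ ind_le G (F_ k).
  move=> lo hi; have [|j j6 [EG GF]] := classification okG tfG cnG.
    move=> T TF /(eta6_lt_schur_norm R b TF); apply/negP; rewrite -leNgt.
    apply: le_trans hi _; rewrite lee_fin.
    have /andP[_] := k6; rewrite leq_eqVlt => /orP[/eqP -> //|k_lt].
    by rewrite ltW // eta_lt // k_lt.
  move: lo hi; rewrite (exact_norm j j6 EG GF) lte_fin lee_fin => lo hi.
  suff -> : k = j by [].
  have /andP[j0 j_6] := j6; have /andP[k0 k_6] := k6.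
  case: (ltngtP k j) => // kj.
    by have := lt_le_trans (@eta_lt R k j _) hi; rewrite kj j_6 ltxx => /(_ isT).
  have [e|ne] := eqVneq j k.-1; first by rewrite e ltxx in lo.
  have : eta_k R j < eta_k R k.-1 by apply: eta_lt; lia.
  by move/(lt_trans lo); rewrite ltxx.
have between : schur_norm R b G = (eta_k R k)%:E ->
    ((eta_k R k.-1)%:E < schur_norm R b G /\
     schur_norm R b G <= (eta_k R k)%:E)%E.
  by move=> ->; rewrite lexx lte_fin eta_lt //; lia.
split; split.
- by case; exact: exact_norm.
- by case/between; exact: to_class.
- exact: between.
- by case=> lo hi; have [] := to_class lo hi; exact: exact_norm.
Qed.
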